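(* Let $\nu$ be a positive integer, $k\le\nu-1$ a real number, $C\neq0$ a constant, and let $\varphi:S\to\mathbb{D}$ be the $\mathcal{D}$-function with parameters $\nu,k,C$. Put $S^*=S\setminus\{0\}$ and $p=\frac{k+1}{2\nu}$. Then for all $t\in(-\infty,0)$ the length $|E_{S^*,\varphi}(t)|$ of the level set $E_{S^*,\varphi}(t)=\{z\in S^*:\ln|\varphi(z)|=t\}$ is $$|E_{S^*,\varphi}(t)|=\frac{2\pi e^t}{|C|}\;{}_2F_1(p,p;1;e^{2\nu t}),$$ where ${}_2F_1(a,b;c;z)$ is the Gauss hypergeometric function.
   Context: Let $\mathbb{D}=\{z\in\mathbb{C}:|z|<1\}$. For a positive integer $\nu$ and a real number $k$ with $k+1\le\nu$ define $$F(z)=\int_0^z\frac{d\zeta}{(1-\zeta^\nu)^{(k+1)/\nu}},\qquad z\in\mathbb{D},$$ where the principal branch of the root is chosen. Under these assumptions on $\nu$ and $k$ the paper asserts, by the Noshiro–Warschawski theorem (positivity of $\mathrm{Re}\,F'$ in $\mathbb{D}$), that $F$ is univalent in $\mathbb{D}$. For $C\ne0$ let $S=\frac1C F(\mathbb{D})$. The $\mathcal{D}$-function with parameters $\nu,k,C$ is the function $\varphi:S\to\mathbb{D}$ given by $F(\varphi(z))=Cz$, $z\in S$; it is analytic and univalent in $S$ and satisfies $\varphi'=C(1-\varphi^\nu)^{(k+1)/\nu}$ there. *)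

(* Defs.v *)
From Stdlib Require Import Reals Factorial.
From Coquelicot Require Import Coquelicot.

Open Scope R_scope.

(* Principal argument, in (-PI, PI], of z <> 0. *)
Definition Arg (z : C) : R :=
  if Rle_dec 0 (Im z) then acos (Re z / Cmod z) else - acos (Re z / Cmod z).

(* Principal branch of w^a = exp (a Log w), for w <> 0 and a real. *)
Definition cpow (w : C) (a : R) : C :=
  Cmult (RtoC (exp (a * ln (Cmod w)))) (cos (a * Arg w), sin (a * Arg w)).

Definition unit_disk (z : C) : Prop := Cmod z < 1.

Definition Fintegrand (nu : nat) (k : R) (zeta : C) : C :=
  Cinv (cpow (Cminus (RtoC 1) (Cpow zeta nu)) ((k + 1) / INR nu)).

(* The integrand is analytic in the disk, so the integral from 0 to z does not
   depend on the path; the path here is s |-> s z, 0 <= s <= 1. *)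
Definition F (nu : nat) (k : R) (z : C) : C :=
  Cmult z
    (RInt (V := C_R_CompleteNormedModule)
       (fun s : R => Fintegrand nu k (Cmult (RtoC s) z)) 0 1).

(* S = (1/c) F(D) *)
Definition domS (nu : nat) (k : R) (c : C) (z : C) : Prop :=
  exists w : C, unit_disk w /\ z = Cdiv (F nu k w) c.

(* Values of phi outside S are irrelevant.  Injectivity of phi on S follows from
   the functional equation.  Analyticity on S makes phi a two-sided inverse of
   F / c: the set of w in D with phi (F w / c) = w is nonempty, closed, and open
   because F' has no zero.  A pointwise right inverse alone would not do if F
   fails to be injective, which happens when k + 1 < - nu. *)
Definition is_D_function (nu : nat) (k : R) (c : C) (phi : C -> C) : Prop :=
  forall z : C, domS nu k c z ->
    unit_disk (phi z) /\
    F nu k (phi z) = Cmult c z /\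
    ex_derive (K := C_AbsRing) (V := C_NormedModule) phi z.

Definition Sstar (nu : nat) (k : R) (c : C) (z : C) : Prop :=
  domS nu k c z /\ z <> RtoC 0.

(* E_{A,f}(t) = {z in A : ln |f z| = t}; ln x is 0 for x <= 0 in the library,
   hence the explicit condition f z <> 0. *)
Definition level_set (A : C -> Prop) (f : C -> C) (t : R) (z : C) : Prop :=
  A z /\ f z <> RtoC 0 /\ ln (Cmod (f z)) = t.

(* U together with the bounds d on the diameters of the U n is a countable
   cover of E by sets of diameter at most delta. *)
Definition delta_cover (delta : R) (E : C -> Prop)
    (U : nat -> C -> Prop) (d : nat -> R) : Prop :=
  (forall z : C, E z -> exists n : nat, U n z) /\
  (forall n : nat, 0 <= d n <= delta) /\
  (forall (n : nat) (x y : C), U n x -> U n y -> Cmod (Cminus x y) <= d n).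

Definition hausdorff1_delta (delta : R) (E : C -> Prop) : Rbar :=
  Rbar_glb (fun s : Rbar =>
    exists (U : nat -> C -> Prop) (d : nat -> R) (l : R),
      delta_cover delta E U d /\ is_series d l /\ s = Finite l).

(* Length of a plane set: its one-dimensional Hausdorff measure, which is the
   usual arc length on rectifiable Jordan curves. *)
Definition length (E : C -> Prop) : Rbar :=
  Rbar_lub (fun s : Rbar =>
    exists delta : R, 0 < delta /\ s = hausdorff1_delta delta E).

(* Pochhammer symbol (a)_n = a (a + 1) ... (a + n - 1). *)
Fixpoint rising (a : R) (n : nat) : R :=
  match n with
  | O => 1
  | S m => rising a m * (a + INR m)
  end.

(* Gauss series, for |x| < 1 and c not a nonpositive integer. *)
Definition hyp2F1 (a b c x : R) : R :=
  PSeries (fun n : nat =>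
    rising a n * rising b n / (rising c n * INR (fact n))) x.

(* Main.v *)
Require Import Defs.
From Stdlib Require Import Reals Factorial Lra Lia Classical ClassicalEpsilon.
From Coquelicot Require Import Coquelicot.
Open Scope R_scope.

(** The level set is the image of the circle [|w| = r], with [r = e^t], under [F / c], and
    [F' w = (1 - w^nu)^(-q)] with [q = (k + 1) / nu = 2 p]. Its length is therefore the
    integral over [[0, 2 PI]] of [r / |c|] times
<<
      |1 - w^nu|^(-2p) = | sum_n b_n w^(nu n) |^2,    b_n = (p)_n / n!,  w = r e^(i x),
>>
    and Parseval's identity evaluates it as [2 PI r / |c|] times the sum of the
    [b_n^2 r^(2 nu n)], which is the Gauss series at [e^(2 nu t)].

    Four facts carry this argument.

    - [binomial_series]: the principal power [(1 - w)^(-a)] is the sum of its Taylor series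
      in the disk, since both solve the same linear equation along each ray. This
      gives the derivative of [F] ([binomial_primitive_derive], [F_eq_primitive]) as well as
      the square above.

    - [D_function_left_inverse]: [phi] is a two-sided inverse of [F / c]. The set of
      points that it recovers is open, because [F] is locally injective, and closed,
      because [phi] is continuous. This makes [F] injective on the disk and
      identifies the level set ([level_set_image]).

    - [length_curve]: the one-dimensional Hausdorff measure of a simple, possibly closed,
      curve with continuous nonvanishing velocity is the integral of its speed. The lower
      bound compares a fine cover of the curve with a cover of an interval
      ([interval_cover_length]); the arcs and chords match because of
      compactness ([arc_le_chord_short]).

    - [parseval]: orthogonality of the exponentials, and uniform convergence of the
      partial sums.

    Complex differentiability is used in the two-point form [strict_derive], which power
    series satisfy by an elementary estimate and which yields chain rule and local
    injectivity without contour integrals. *)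

(** * Moduli and absolutely convergent complex series *)

(** Equations coming from the algebraic hierarchy live in the carrier of a structure
    on [R], which [ring] and [field] do not recognise as [R]. *)
Ltac as_real := match goal with |- @eq _ ?a ?b => change (@eq R a b) end.

Lemma im_le_Cmod (z : C) : Rabs (Im z) <= Cmod z.
Proof.
  eapply Rle_trans; [apply Rmax_r | apply Rmax_Cmod].
Qed.

Lemma Cmod_minus_sym (z w : C) : Cmod (z - w)%C = Cmod (w - z)%C.
Proof.
  rewrite <- Cmod_opp. f_equal. ring.
Qed.

Lemma Cmod_triangle_minus (z w : C) : Cmod (z - w)%C <= Cmod z + Cmod w.
Proof.
  unfold Cminus. rewrite <- (Cmod_opp w). apply Cmod_triangle.
Qed.

Lemma Cmod_triangle_inv (z w : C) : Rabs (Cmod z - Cmod w) <= Cmod (z - w)%C.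
Proof.
  apply Rabs_le; split.
  - assert (H := Cmod_triangle z (w - z)).
    replace (z + (w - z))%C with w in H by ring.
    rewrite (Cmod_minus_sym w z) in H. lra.
  - assert (H := Cmod_triangle w (z - w)).
    replace (w + (z - w))%C with z in H by ring. lra.
Qed.

Lemma Cmod_le_Re_Im (z : C) : Cmod z <= Rabs (Re z) + Rabs (Im z).
Proof.
  replace z with (RtoC (Re z) + Ci * RtoC (Im z))%C at 1.
  - eapply Rle_trans; [apply Cmod_triangle |].
    rewrite Cmod_mult, Cmod_Ci, !Cmod_R. lra.
  - destruct z as [x y]. unfold RtoC, Ci, Cmult, Cplus; simpl.
    f_equal; ring.
Qed.

Lemma Series_nonneg (u : nat -> R) :
  (forall n, 0 <= u n) -> ex_series u -> 0 <= Series u.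
Proof.
  intros H Hu. rewrite <- (Rmult_0_l (Series u)), <- Series_scal_l.
  apply Series_le; [| exact Hu]. intros n. rewrite Rmult_0_l.
  split; [lra | apply H].
Qed.

Lemma Series_ge_term (n : nat) (u : nat -> R) :
  (forall k, 0 <= u k) -> ex_series u -> u n <= Series u.
Proof.
  revert u. induction n as [| n IH]; intros u H Hu; rewrite Series_incr_1 by exact Hu;
    assert (Hu' := proj1 (ex_series_incr_1 u) Hu).
  - generalize (Series_nonneg (fun k => u (S k)) (fun k => H (S k)) Hu'). lra.
  - generalize (IH (fun k => u (S k)) (fun k => H (S k)) Hu') (H 0%nat). lra.
Qed.

Definition cseries (u : nat -> C) : C :=
  (Series (fun n => Re (u n)), Series (fun n => Im (u n))).

Definition abs_summable (u : nat -> C) : Prop := ex_series (fun n => Cmod (u n)).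

Lemma ex_series_Re (u : nat -> C) :
  abs_summable u -> ex_series (fun n => Re (u n)).
Proof.
  intros H. apply (ex_series_le (V := R_CompleteNormedModule)) with (2 := H).
  intros n. apply re_le_Cmod.
Qed.

Lemma ex_series_Im (u : nat -> C) :
  abs_summable u -> ex_series (fun n => Im (u n)).
Proof.
  intros H. apply (ex_series_le (V := R_CompleteNormedModule)) with (2 := H).
  intros n. apply im_le_Cmod.
Qed.

Lemma abs_summable_le (u : nat -> C) (b : nat -> R) :
  (forall n, Cmod (u n) <= b n) -> ex_series b -> abs_summable u.
Proof.
  intros H Hb. apply (ex_series_le (V := R_CompleteNormedModule)) with (2 := Hb).
  intros n. unfold norm; simpl. unfold abs; simpl.
  rewrite Rabs_pos_eq; [apply H | apply Cmod_ge_0].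
Qed.

Lemma cseries_ext (u v : nat -> C) :
  (forall n, u n = v n) -> cseries u = cseries v.
Proof.
  intros H. unfold cseries.
  f_equal; apply Series_ext; intros n; now rewrite H.
Qed.

Lemma cseries_plus (u v : nat -> C) :
  abs_summable u -> abs_summable v ->
  cseries (fun n => u n + v n)%C = (cseries u + cseries v)%C.
Proof.
  intros Hu Hv. unfold cseries, Cplus; simpl. f_equal.
  - rewrite <- Series_plus by now apply ex_series_Re. now apply Series_ext.
  - rewrite <- Series_plus by now apply ex_series_Im. now apply Series_ext.
Qed.

Lemma abs_summable_scal (c : C) (u : nat -> C) :
  abs_summable u -> abs_summable (fun n => c * u n)%C.
Proof.
  intros Hu. apply abs_summable_le with (b := fun n => Cmod c * Cmod (u n)).
  - intros n. rewrite Cmod_mult. apply Rle_refl.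
  - now apply @ex_series_scal_l with (V := R_NormedModule).
Qed.

Lemma cseries_scal (c : C) (u : nat -> C) :
  abs_summable u -> cseries (fun n => c * u n)%C = (c * cseries u)%C.
Proof.
  intros Hu. assert (HR := ex_series_Re u Hu). assert (HI := ex_series_Im u Hu).
  assert (S : forall (x : R) (a : nat -> R), ex_series a ->
                ex_series (fun n => x * a n)).
  { intros x a Ha. now apply @ex_series_scal_l with (V := R_NormedModule). }
  unfold cseries, Cmult; simpl. f_equal.
  - rewrite <- !Series_scal_l, <- Series_minus by now apply S.
    now apply Series_ext.
  - rewrite <- !Series_scal_l, <- Series_plus by now apply S.
    now apply Series_ext.
Qed.

Lemma cseries_minus (u v : nat -> C) :
  abs_summable u -> abs_summable v ->
  cseries (fun n => u n - v n)%C = (cseries u - cseries v)%C.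
Proof.
  intros Hu Hv. unfold cseries, Cminus, Cplus, Copp; simpl. f_equal.
  - replace (Series (fun n => Re (u n)) + - Series (fun n => Re (v n)))
      with (Series (fun n => Re (u n)) - Series (fun n => Re (v n))) by ring.
    rewrite <- Series_minus by now apply ex_series_Re. now apply Series_ext.
  - replace (Series (fun n => Im (u n)) + - Series (fun n => Im (v n)))
      with (Series (fun n => Im (u n)) - Series (fun n => Im (v n))) by ring.
    rewrite <- Series_minus by now apply ex_series_Im. now apply Series_ext.
Qed.

Lemma cseries_incr_1 (u : nat -> C) :
  abs_summable u -> cseries u = (u 0%nat + cseries (fun n => u (S n)))%C.
Proof.
  intros Hu. unfold cseries, Cplus; simpl. f_equal; apply Series_incr_1.
  - now apply ex_series_Re.
  - now apply ex_series_Im.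
Qed.

(** Rotating the sum onto the positive real axis reduces the bound to the
    comparison of real series: [|l|^2 = Re (conj l * l)] is the sum of the
    [Re (conj l * u n)], each at most [|l| |u n|]. *)
Lemma Cmod_cseries_le (u : nat -> C) (b : nat -> R) :
  (forall n, Cmod (u n) <= b n) -> ex_series b -> Cmod (cseries u) <= Series b.
Proof.
  intros Hub Hb. assert (Hu := abs_summable_le u b Hub Hb).
  set (l := cseries u).
  assert (Hb0 : 0 <= Series b).
  { apply Series_nonneg; [| exact Hb]. intros n.
    eapply Rle_trans; [apply Cmod_ge_0 | apply Hub]. }
  destruct (Req_dec (Cmod l) 0) as [E | E]; [rewrite E; exact Hb0 |].
  assert (P : 0 < Cmod l) by (generalize (Cmod_ge_0 l); lra).
  apply Rmult_le_reg_l with (Cmod l); [exact P |].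
  assert (Q : Cmod l * Cmod l = Re (Cconj l * l)%C).
  { replace (Cmod l * Cmod l) with (Cmod l ^ 2) by ring.
    rewrite Cmod2_alt. destruct l as [x y]. simpl. ring. }
  rewrite Q. unfold l at 2. rewrite <- cseries_scal by exact Hu.
  unfold cseries; simpl.
  rewrite <- Series_scal_l.
  assert (HS : ex_series (fun n => Cmod l * b n))
    by now apply @ex_series_scal_l with (V := R_NormedModule).
  assert (B : forall n, Rabs (Re (Cconj l * u n)%C) <= Cmod l * b n).
  { intros n. eapply Rle_trans; [apply re_le_Cmod |].
    rewrite Cmod_mult, Cmod_conj. apply Rmult_le_compat_l; [lra | apply Hub]. }
  eapply Rle_trans; [apply Rle_abs |].
  eapply Rle_trans; [apply Series_Rabs |].
  - apply (ex_series_le (V := R_CompleteNormedModule)) with (2 := HS).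
    intros n. unfold norm; simpl. unfold abs; simpl. rewrite Rabs_Rabsolu. apply B.
  - apply Series_le; [| exact HS]. intros n. split; [apply Rabs_pos | apply B].
Qed.

(** * Complex power series and their strict derivatives *)

(** The coefficients are real, so that [CV_radius] of the real series governs
    convergence at complex points as well. *)
Definition cps (b : nat -> R) (z : C) : C :=
  cseries (fun n => RtoC (b n) * z ^ n)%C.

Lemma CV_abs_ex_series (b : nat -> R) (r : R) :
  Rbar_le 1 (CV_radius b) -> 0 <= r < 1 ->
  ex_series (fun n => Rabs (b n) * r ^ n).
Proof.
  intros Hb Hr. apply ex_series_ext with (fun n => Rabs (b n * r ^ n)).
  - intros n. rewrite Rabs_mult. f_equal. apply Rabs_pos_eq, pow_le; lra.
  - apply CV_disk_inside. eapply Rbar_lt_le_trans; [| exact Hb].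
    simpl. rewrite Rabs_pos_eq; lra.
Qed.

Lemma cps_summable (b : nat -> R) (z : C) :
  Rbar_le 1 (CV_radius b) -> Cmod z < 1 ->
  abs_summable (fun n => RtoC (b n) * z ^ n)%C.
Proof.
  intros Hb Hz. apply abs_summable_le with (fun n => Rabs (b n) * Cmod z ^ n).
  - intros n. rewrite Cmod_mult, Cmod_R, Cmod_pow. apply Rle_refl.
  - apply CV_abs_ex_series; [exact Hb |]. split; [apply Cmod_ge_0 | exact Hz].
Qed.

(** The two-point form of differentiability at [z0]: unlike the derivative at the point
    alone, it gives injectivity near [z0] when [d] is not zero, without any appeal to
    the continuity of the derivative. *)
Definition strict_derive (f : C -> C) (z0 d : C) : Prop :=
  forall eps, 0 < eps -> exists delta, 0 < delta /\
    forall z w, Cmod (z - z0)%C < delta -> Cmod (w - z0)%C < delta ->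
      Cmod (f z - f w - d * (z - w))%C <= eps * Cmod (z - w)%C.

Lemma pow_diff_bound (n : nat) (z w z0 : C) (r e : R) :
  Cmod z <= r -> Cmod w <= r -> Cmod z0 <= r ->
  Cmod (z - z0)%C <= e -> Cmod (w - z0)%C <= e ->
  Cmod (w ^ n - z0 ^ n)%C <= INR n * r ^ (pred n) * e.
Proof.
  intros Hz Hw H0 Hze Hwe.
  assert (Hr : 0 <= r) by (eapply Rle_trans; [apply Cmod_ge_0 | exact Hz]).
  assert (He : 0 <= e) by (eapply Rle_trans; [apply Cmod_ge_0 | exact Hze]).
  induction n as [| n IH].
  - simpl. replace (1 - 1)%C with (RtoC 0) by (rewrite <- RtoC_minus; f_equal; ring).
    rewrite Cmod_0. lra.
  - replace (w ^ S n - z0 ^ S n)%C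
      with (w * (w ^ n - z0 ^ n) + (w - z0) * z0 ^ n)%C
      by (rewrite !Cpow_S; ring).
    eapply Rle_trans; [apply Cmod_triangle |]. rewrite !Cmod_mult, Cmod_pow.
    assert (A1 : Cmod w * Cmod (w ^ n - z0 ^ n)%C
                 <= r * (INR n * r ^ pred n * e)).
    { apply Rmult_le_compat; auto using Cmod_ge_0. }
    assert (A2 : Cmod (w - z0)%C * Cmod z0 ^ n <= e * r ^ n).
    { apply Rmult_le_compat; auto using Cmod_ge_0, pow_le.
      apply pow_incr. split; [apply Cmod_ge_0 | exact H0]. }
    assert (E : r * (INR n * r ^ pred n * e) = INR n * r ^ n * e).
    { destruct n as [| n]; [simpl; ring |]. simpl pred. simpl pow. ring. }
    rewrite S_INR. simpl pred. lra.
Qed.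

(** The induction is on [z^(n+1) - w^(n+1) - (n+1) z0^n (z-w)
    = z (z^n - w^n - n z0^(n-1) (z-w)) + (z-w) (w^n - z0^n) + n z0^(n-1) (z-z0) (z-w)],
    which is why the bound is the second derivative of [r^(n+1)]. *)
Lemma pow_strict_bound (n : nat) (z w z0 : C) (r e : R) :
  Cmod z <= r -> Cmod w <= r -> Cmod z0 <= r ->
  Cmod (z - z0)%C <= e -> Cmod (w - z0)%C <= e ->
  Cmod (z ^ S n - w ^ S n - RtoC (INR (S n)) * z0 ^ n * (z - w))%C
  <= INR (S n) * INR n * r ^ (pred n) * e * Cmod (z - w)%C.
Proof.
  intros Hz Hw H0 Hze Hwe.
  assert (Hr : 0 <= r) by (eapply Rle_trans; [apply Cmod_ge_0 | exact Hz]).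
  assert (He : 0 <= e) by (eapply Rle_trans; [apply Cmod_ge_0 | exact Hze]).
  induction n as [| n IH].
  - replace (z ^ 1 - w ^ 1 - RtoC (INR 1) * z0 ^ 0 * (z - w))%C with (RtoC 0)
      by (simpl; ring).
    rewrite Cmod_0. simpl. lra.
  - replace (z ^ S (S n) - w ^ S (S n) - RtoC (INR (S (S n))) * z0 ^ S n * (z - w))%C
      with (z * (z ^ S n - w ^ S n - RtoC (INR (S n)) * z0 ^ n * (z - w))
            + (z - w) * (w ^ S n - z0 ^ S n)
            + RtoC (INR (S n)) * z0 ^ n * (z - z0) * (z - w))%C
      by (rewrite (S_INR (S n)), RtoC_plus, !Cpow_S; ring).
    eapply Rle_trans; [apply Cmod_triangle |].
    eapply Rle_trans; [apply Rplus_le_compat_r, Cmod_triangle |].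
    rewrite !(Cmod_mult z), !(Cmod_mult (z - w)).
    rewrite !Cmod_mult, Cmod_R, Cmod_pow.
    rewrite (Rabs_pos_eq (INR (S n))) by apply pos_INR.
    assert (D := Cmod_ge_0 (z - w)%C). set (d := Cmod (z - w)%C) in *.
    assert (A1 : Cmod z * Cmod (z ^ S n - w ^ S n - RtoC (INR (S n)) * z0 ^ n * (z - w))%C
                 <= r * (INR (S n) * INR n * r ^ pred n * e * d)).
    { apply Rmult_le_compat; auto using Cmod_ge_0. }
    assert (A2 : d * Cmod (w ^ S n - z0 ^ S n)%C <= d * (INR (S n) * r ^ n * e)).
    { apply Rmult_le_compat_l; [exact D |].
      apply (pow_diff_bound (S n) z w z0 r e); assumption. }
    assert (A3 : INR (S n) * Cmod z0 ^ n * Cmod (z - z0)%C * d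
                 <= INR (S n) * r ^ n * e * d).
    { apply Rmult_le_compat_r; [exact D |].
      apply Rmult_le_compat; auto using Cmod_ge_0.
      - apply Rmult_le_pos; [apply pos_INR | apply pow_le, Cmod_ge_0].
      - apply Rmult_le_compat_l; [apply pos_INR |].
        apply pow_incr. split; [apply Cmod_ge_0 | exact H0]. }
    assert (E : r * (INR (S n) * INR n * r ^ pred n * e * d)
                = INR (S n) * INR n * r ^ n * e * d).
    { destruct n as [| n]; [simpl; ring |]. simpl pred. simpl pow. ring. }
    replace (INR (S (S n)) * INR (S n) * r ^ pred (S n) * e * d)
      with (INR (S n) * INR n * r ^ n * e * d + d * (INR (S n) * r ^ n * e)
            + INR (S n) * r ^ n * e * d)
      by (rewrite (S_INR (S n)), (S_INR n); simpl pred; ring).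
    lra.
Qed.

(** Termwise differentiation: by [pow_strict_bound] the error is at most [e |z - w|]
    times the sum of the second derivatives of the terms, taken with absolute values at
    a radius [r < 1]. *)
Lemma cps_strict_derive (b : nat -> R) (z0 : C) :
  Rbar_le 1 (CV_radius b) -> Cmod z0 < 1 ->
  strict_derive (cps b) z0 (cps (PS_derive b) z0).
Proof.
  intros Hb Hz0.
  assert (Hb1 : Rbar_le 1 (CV_radius (PS_derive b)))
    by now rewrite CV_radius_derive.
  assert (Hb2 : Rbar_le 1 (CV_radius (PS_derive (PS_derive b))))
    by now rewrite CV_radius_derive.
  (* any radius strictly between |z0| and 1 *)
  set (r := (Cmod z0 + 1) / 2).
  assert (P0 := Cmod_ge_0 z0).
  assert (Hr : 0 <= r < 1) by (unfold r; lra).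
  set (kappa := fun n => Rabs (b (S n)) * (INR (S n) * INR n * r ^ pred n)).
  assert (Hk : ex_series kappa).
  { apply ex_series_incr_1.
    apply ex_series_ext with
      (fun n => Rabs (PS_derive (PS_derive b) n) * r ^ n).
    - intros n. unfold kappa, PS_derive.
      rewrite !Rabs_mult, !(Rabs_pos_eq (INR _)) by apply pos_INR.
      simpl pred. as_real. ring.
    - now apply CV_abs_ex_series. }
  assert (K0 : 0 <= Series kappa).
  { apply Series_nonneg; [| exact Hk]. intros n. unfold kappa.
    repeat apply Rmult_le_pos; auto using Rabs_pos, pos_INR.
    apply pow_le; lra. }
  intros eps He.
  set (e := Rmin (r - Cmod z0) (eps / (Series kappa + 1))).
  assert (He0 : 0 < e).
  { apply Rmin_pos; [unfold r; lra |]. apply Rdiv_lt_0_compat; lra. }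
  exists e. split; [exact He0 |]. intros z w Hz Hw.
  assert (er : e <= r - Cmod z0) by apply Rmin_l.
  assert (Hzr : Cmod z <= r).
  { replace z with (z0 + (z - z0))%C by ring.
    eapply Rle_trans; [apply Cmod_triangle | lra]. }
  assert (Hwr : Cmod w <= r).
  { replace w with (z0 + (w - z0))%C by ring.
    eapply Rle_trans; [apply Cmod_triangle | lra]. }
  assert (Sz := cps_summable b z Hb ltac:(lra)).
  assert (Sw := cps_summable b w Hb ltac:(lra)).
  assert (S0 := cps_summable (PS_derive b) z0 Hb1 Hz0).
  assert (E : (cps b z - cps b w - cps (PS_derive b) z0 * (z - w))%C
     = cseries (fun n => RtoC (b (S n)) *
         (z ^ S n - w ^ S n - RtoC (INR (S n)) * z0 ^ n * (z - w)))%C).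
  { unfold cps. rewrite (cseries_incr_1 _ Sz), (cseries_incr_1 _ Sw).
    assert (Sz' : abs_summable (fun n => RtoC (b (S n)) * z ^ S n)%C)
      by (apply ex_series_incr_1 in Sz; exact Sz).
    assert (Sw' : abs_summable (fun n => RtoC (b (S n)) * w ^ S n)%C)
      by (apply ex_series_incr_1 in Sw; exact Sw).
    rewrite (cseries_ext
      (fun n => RtoC (b (S n)) *
         (z ^ S n - w ^ S n - RtoC (INR (S n)) * z0 ^ n * (z - w)))%C
      (fun n => (RtoC (b (S n)) * z ^ S n - RtoC (b (S n)) * w ^ S n)
       - (z - w) * (RtoC (PS_derive b n) * z0 ^ n))%C).
    - rewrite cseries_minus, cseries_minus, cseries_scal; auto.
      + change (z ^ 0)%C with (RtoC 1). change (w ^ 0)%C with (RtoC 1). ring.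
      + apply abs_summable_le with
          (fun n => Cmod (RtoC (b (S n)) * z ^ S n)%C + Cmod (RtoC (b (S n)) * w ^ S n)%C).
        * intros n. apply Cmod_triangle_minus.
        * now apply @ex_series_plus with (V := R_NormedModule).
      + now apply abs_summable_scal.
    - intros n. unfold PS_derive. rewrite RtoC_mult. ring. }
  rewrite E.
  assert (D := Cmod_ge_0 (z - w)%C). set (d := Cmod (z - w)%C) in *.
  eapply Rle_trans.
  - apply (Cmod_cseries_le _ (fun n => (e * d) * kappa n)).
    + intros n. rewrite Cmod_mult, Cmod_R. unfold kappa.
      replace (e * d * (Rabs (b (S n)) * (INR (S n) * INR n * r ^ pred n)))
        with (Rabs (b (S n)) * (INR (S n) * INR n * r ^ pred n * e * d)) by ring.
      apply Rmult_le_compat_l; [apply Rabs_pos |].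
      apply pow_strict_bound; lra.
    + now apply @ex_series_scal_l with (V := R_NormedModule).
  - rewrite Series_scal_l.
    assert (L : e * (Series kappa + 1) <= eps).
    { unfold e. eapply Rle_trans.
      - apply Rmult_le_compat_r; [lra | apply Rmin_r].
      - right. field. lra. }
    replace (e * d * Series kappa) with (e * Series kappa * d) by ring.
    apply Rmult_le_compat_r; [exact D |]. nra.
Qed.

(** * Covers of an interval and of a curve *)

(** Connectedness of [[a, b]], by way of the supremum of the points up to which [P] holds. *)
Lemma interval_connected (P : R -> Prop) (a b : R) :
  a <= b -> P a ->
  (forall x, a <= x <= b -> exists delta, 0 < delta /\
     forall y z, a <= y <= b -> a <= z <= b ->
       Rabs (y - x) < delta -> Rabs (z - x) < delta -> P y -> P z) ->
  P b.
Proof.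
  intros Hab Ha H.
  set (E := fun x => a <= x <= b /\ forall y, a <= y <= x -> P y).
  assert (Ea : E a).
  { split; [lra |]. intros y Hy. now replace y with a by lra. }
  destruct (completeness E) as [m [Hm1 Hm2]].
  - exists b. intros x [Hx _]. lra.
  - now exists a.
  - assert (Hma : a <= m) by now apply Hm1.
    assert (Hmb : m <= b) by (apply Hm2; intros x [Hx _]; lra).
    destruct (H m) as (delta & Hd & K); [lra |].
    assert (exists x, E x /\ m - delta < x) as (x & [Hx1 Hx2] & Hx3).
    { apply NNPP. intros N. assert (m <= m - delta); [| lra].
      apply Hm2. intros x Hx. apply Rnot_lt_le. intros L. apply N. now exists x. }
    assert (Hxm : x <= m) by now apply Hm1.
    assert (Q : forall y, a <= y <= b -> y < m + delta -> P y).
    { intros y Hy Hy'. destruct (Rle_dec y x) as [L | L]; [apply Hx2; lra |].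
      apply (K x y); [lra | lra | | | apply Hx2; lra];
        apply Rabs_def1; lra. }
    destruct (Req_dec m b) as [-> | Nm]; [apply Q; lra |].
    exfalso. set (m' := Rmin b (m + delta / 2)).
    assert (m' <= b) by apply Rmin_l.
    assert (m' <= m + delta / 2) by apply Rmin_r.
    assert (m < m') by (apply Rmin_glb_lt; lra).
    assert (m' <= m); [| lra].
    apply Hm1. split; [lra |]. intros y Hy. apply Q; lra.
Qed.

(** The hull starts at the infimum; an interval centred at a point of [W] would be twice
    as long. *)
Lemma bounded_diam_hull (W : R -> Prop) (d : R) :
  (forall x y, W x -> W y -> Rabs (x - y) <= d) ->
  forall x, W x -> real (Glb_Rbar W) <= x <= real (Glb_Rbar W) + d.
Proof.
  intros H x Hx. destruct (Glb_Rbar_correct W) as [G1 G2].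
  assert (L : Rbar_le (x - d) (Glb_Rbar W)).
  { apply G2. intros y Hy. simpl. generalize (Rle_abs (x - y)) (H x y Hx Hy). lra. }
  assert (U := G1 x Hx).
  destruct (Glb_Rbar W) as [g | |]; simpl in *; lra.
Qed.

(** Countable subadditivity of length. Each [W n] is enlarged to an open interval;
    the total length of the parts of these that lie to the left of [x], minus [x], is
    locally nondecreasing, because near any point one of them contributes slope one. *)
Lemma interval_cover_length (a b : R) (W : nat -> R -> Prop) (d : nat -> R) (l : R) :
  a <= b ->
  (forall x, a <= x <= b -> exists n, W n x) ->
  (forall n, 0 <= d n) ->
  (forall n x y, W n x -> W n y -> Rabs (x - y) <= d n) ->
  is_series d l ->
  b - a <= l.
Proof.
  intros Hab Hcov Hd Hdiam Hl.
  apply le_epsilon. intros eps Heps.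
  (* each end of W n moves by eta n, and the sum of the 2 eta n is eps *)
  set (eta := fun n => eps / 4 * (/ 2) ^ n).
  assert (Heta : forall n, 0 < eta n).
  { intros n. unfold eta. apply Rmult_lt_0_compat; [lra | apply pow_lt; lra]. }
  set (lo := fun n => real (Glb_Rbar (W n)) - eta n).
  set (wd := fun n => d n + 2 * eta n).
  assert (Hwd : is_series wd (l + eps)).
  { apply (is_series_plus (V := R_NormedModule)); [exact Hl |].
    replace eps with (2 * (eps / 4 * / (1 - / 2))) by field.
    apply (is_series_scal (V := R_NormedModule) 2 eta (eps / 4 * / (1 - / 2))).
    apply (is_series_scal (V := R_NormedModule) (eps / 4)).
    apply is_series_geom. rewrite Rabs_pos_eq; lra. }
  set (part := fun n x => Rmax 0 (Rmin (x - lo n) (wd n))).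
  assert (Hwd0 : forall n, 0 <= wd n).
  { intros n. unfold wd. generalize (Hd n) (Heta n). lra. }
  assert (Hpart : forall n x, 0 <= part n x <= wd n).
  { intros n x. unfold part. split; [apply Rmax_l |].
    apply Rmax_lub; [apply Hwd0 | apply Rmin_r]. }
  assert (Hex : forall x, ex_series (fun n => part n x)).
  { intros x. apply (ex_series_le (V := R_CompleteNormedModule)) with wd;
      [| now exists (l + eps)].
    intros n. unfold norm; simpl. unfold abs; simpl.
    rewrite Rabs_pos_eq; apply Hpart. }
  assert (Hmono : forall n x y, x <= y -> part n x <= part n y).
  { intros n x y Hxy. unfold part. apply Rle_max_compat_l.
    apply Rle_min_compat_r. lra. }
  set (g := fun x => Series (fun n => part n x) - x).
  assert (G : forall y, a <= y <= b -> g a <= g y).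
  { apply (interval_connected (fun x => forall y, a <= y <= x -> g a <= g y) a b Hab).
    - intros y Hy. replace y with a by lra. lra.
    - intros x Hx. destruct (Hcov x Hx) as [n Wn].
      exists (eta n). split; [apply Heta |].
      assert (Hull := bounded_diam_hull (W n) (d n) (Hdiam n) x Wn).
      assert (Loc : forall y z, y <= z -> Rabs (y - x) < eta n ->
                Rabs (z - x) < eta n -> g y <= g z).
      { intros y z Hyz Hy Hz. apply Rabs_def2 in Hy. apply Rabs_def2 in Hz.
        unfold g.
        assert (T : z - y <= Series (fun k => part k z) - Series (fun k => part k y));
          [| lra].
        rewrite <- Series_minus by apply Hex.
        eapply Rle_trans; [| apply (Series_ge_term n (fun k => part k z - part k y))].
        - assert (Ey : part n y = y - lo n).
          { unfold part, lo, wd. rewrite Rmin_left by lra. apply Rmax_right; lra. }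
          assert (Ez : part n z = z - lo n).
          { unfold part, lo, wd. rewrite Rmin_left by lra. apply Rmax_right; lra. }
          rewrite Ey, Ez. lra.
        - intros k. generalize (Hmono k y z Hyz). lra.
        - apply (ex_series_minus (V := R_NormedModule)); apply Hex. }
      intros y z Hy Hz Hyx Hzx Py u Hu.
      destruct (Rle_dec u y) as [L | L]; [apply Py; lra |].
      apply Rle_trans with (g y); [apply Py; lra |].
      apply Loc; [lra | exact Hyx |].
      apply Rabs_def2 in Hyx. apply Rabs_def2 in Hzx. apply Rabs_def1; lra. }
  specialize (G b (conj Hab (Rle_refl b))). unfold g in G.
  assert (P0 : 0 <= Series (fun n => part n a)).
  { apply Series_nonneg; [| apply Hex]. intros n. apply Hpart. }
  assert (P1 : Series (fun n => part n b) <= l + eps).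
  { rewrite <- (is_series_unique _ _ Hwd). apply Series_le; [| now exists (l + eps)].
    intros n. apply Hpart. }
  lra.
Qed.

Lemma is_series_const_prefix (h : R) (N : nat) :
  is_series (fun n => if Nat.ltb n N then h else 0) (INR N * h).
Proof.
  induction N as [| N IH].
  - replace (INR 0 * h) with (0 * 0) by (simpl; ring).
    apply is_series_ext with (fun n => 0 * (1 / 2) ^ n).
    + intros n. simpl. as_real. ring.
    + replace (0 * 0) with (0 * / (1 - 1 / 2)) by field.
      apply (is_series_scal (V := R_NormedModule) 0).
      apply is_series_geom. rewrite Rabs_pos_eq; lra.
  - apply is_series_decr_1.
    change (is_series (fun n => if Nat.ltb n N then h else 0)
              (plus (INR (S N) * h) (opp h))).
    replace (plus (INR (S N) * h) (opp h)) with (INR N * h); [exact IH |].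
    rewrite S_INR. unfold plus, opp; simpl. ring.
Qed.

Lemma equal_pieces (s h : R) (N : nat) :
  (0 < N)%nat -> 0 <= s <= INR N * h ->
  exists n, (n < N)%nat /\ INR n * h <= s <= INR (S n) * h.
Proof.
  induction N as [| N IH]; [lia |]. intros _ Hs.
  destruct (Rle_dec (INR N * h) s) as [L | L].
  - exists N. split; [lia | lra].
  - destruct N as [| N]; [simpl in L; lra |].
    destruct IH as (n & Hn & Hns); [lia | lra |].
    exists n. split; [lia | exact Hns].
Qed.

(** Pieces of equal [sigma]-length have diameters that add up to [sigma b - sigma a]. *)
Lemma hausdorff1_delta_le (E : C -> Prop) (gamma : R -> C) (sigma : R -> R)
    (a b delta : R) :
  a <= b -> 0 < delta ->
  (forall z, E z -> exists x, a <= x <= b /\ z = gamma x) ->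
  (forall x y, a <= x <= y -> y <= b -> Cmod (gamma y - gamma x)%C <= sigma y - sigma x) ->
  Rbar_le (hausdorff1_delta delta E) (sigma b - sigma a).
Proof.
  intros Hab Hdelta HE Hch.
  assert (Mono : forall x y, a <= x <= y -> y <= b -> sigma x <= sigma y).
  { intros x y Hx Hy. generalize (Hch x y Hx Hy) (Cmod_ge_0 (gamma y - gamma x)%C). lra. }
  set (L := sigma b - sigma a).
  assert (HL : 0 <= L) by (generalize (Mono a b); unfold L; lra).
  destruct (nfloor_ex (L / delta)) as [M [_ HM]].
  { apply Rmult_le_pos; [exact HL |]. left. now apply Rinv_0_lt_compat. }
  set (N := S M). set (h := L / INR N).
  assert (HN : 0 < INR N) by apply lt_0_INR, Nat.lt_0_succ.
  assert (Hh : 0 <= h) by (apply Rmult_le_pos; [exact HL | left; now apply Rinv_0_lt_compat]).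
  assert (HNh : INR N * h = L) by (unfold h; field; lra).
  assert (Hhd : h <= delta).
  { apply Rmult_le_reg_l with (INR N); [exact HN |]. rewrite HNh.
    unfold N. rewrite S_INR. apply Rmult_lt_compat_r with (r := delta) in HM; [| exact Hdelta].
    unfold Rdiv in HM. rewrite Rmult_assoc, Rinv_l, Rmult_1_r in HM by lra. lra. }
  unfold hausdorff1_delta, Rbar_glb.
  destruct (Rbar_ex_glb _) as [g [G1 G2]]. simpl.
  apply G1.
  exists (fun n z => exists x, a <= x <= b /\ z = gamma x /\
            INR n * h <= sigma x - sigma a <= INR (S n) * h /\ (n < N)%nat).
  exists (fun n => if Nat.ltb n N then h else 0), L.
  split; [split; [| split] | split; [| reflexivity]].
  - intros z Hz. destruct (HE z Hz) as (x & Hx & ->).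
    destruct (equal_pieces (sigma x - sigma a) h N) as (n & Hn & Hns).
    + apply Nat.lt_0_succ.
    + rewrite HNh. unfold L. generalize (Mono a x) (Mono x b). lra.
    + exists n, x. tauto.
  - intros n. destruct (Nat.ltb n N); lra.
  - assert (K : forall n x y, a <= x <= y -> y <= b ->
       INR n * h <= sigma x - sigma a -> sigma y - sigma a <= INR (S n) * h ->
       Cmod (gamma y - gamma x)%C <= h).
    { intros n x y Hx Hy H1 H2. eapply Rle_trans; [now apply Hch |].
      rewrite S_INR in H2. lra. }
    intros n z1 z2 (x & Hx & -> & Sx & Hn) (y & Hy & -> & Sy & _).
    apply Nat.ltb_lt in Hn. rewrite Hn.
    destruct (Rle_dec x y) as [Lxy | Lxy].
    + rewrite Cmod_minus_sym. apply (K n); lra.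
    + apply (K n); lra.
  - rewrite <- HNh. apply is_series_const_prefix.
Qed.

(** If short chords are at least [1 / kappa] times the [sigma]-length that they
    span, every fine cover of the curve pulls back to a cover of [[sigma a, sigma b]]. *)
Lemma hausdorff1_delta_ge (E : C -> Prop) (gamma : R -> C) (sigma : R -> R)
    (a b delta kappa : R) :
  a <= b -> 0 < kappa ->
  (forall x, continuous sigma x) -> sigma a <= sigma b ->
  (forall x, a <= x <= b -> E (gamma x)) ->
  (forall x y, a <= x <= b -> a <= y <= b -> Cmod (gamma x - gamma y)%C <= delta ->
     Rabs (sigma x - sigma y) <= kappa * Cmod (gamma x - gamma y)%C) ->
  Rbar_le ((sigma b - sigma a) / kappa) (hausdorff1_delta delta E).
Proof.
  intros Hab Hk Hcont Hs HE Hch.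
  unfold hausdorff1_delta, Rbar_glb.
  destruct (Rbar_ex_glb _) as [g [G1 G2]]. simpl.
  apply (G2 (Finite ((sigma b - sigma a) / kappa))).
  intros s (U & d & l & (Ucov & Ud & Udiam) & Hl & ->). simpl.
  apply Rmult_le_reg_l with kappa; [exact Hk |].
  replace (kappa * ((sigma b - sigma a) / kappa)) with (sigma b - sigma a) by (field; lra).
  apply (interval_cover_length (sigma a) (sigma b)
    (fun n s => exists x, a <= x <= b /\ sigma x = s /\ U n (gamma x))
    (fun n => kappa * d n)); [exact Hs | | | |].
  - intros s Hs'. destruct (IVT_gen_consistent sigma a b s Hcont) as (x & Hx & Ex).
    + rewrite Rmin_left, Rmax_right by exact Hs. exact Hs'.
    + rewrite Rmin_left, Rmax_right in Hx by exact Hab.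
      destruct (Ucov (gamma x) (HE x Hx)) as [n Hn]. exists n, x. auto.
  - intros n. apply Rmult_le_pos; [lra | apply Ud].
  - intros n s1 s2 (x & Hx & <- & Ux) (y & Hy & <- & Uy).
    assert (Hn := Udiam n _ _ Ux Uy).
    eapply Rle_trans; [apply Hch; auto |].
    + eapply Rle_trans; [exact Hn | apply Ud].
    + apply Rmult_le_compat_l; [lra | exact Hn].
  - now apply (is_series_scal (V := R_NormedModule)).
Qed.

(** * The length of a regular curve *)

Notation curve_derive gamma x v :=
  (is_derive (K := R_AbsRing) (V := C_R_NormedModule) gamma x v).

Notation curve_continuous gamma x :=
  (continuous (T := R_UniformSpace) (U := C_UniformSpace) gamma x).

Lemma curve_continuous_iff (gamma : R -> C) (x : R) :
  curve_continuous gamma x <->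
  forall eps, 0 < eps -> exists delta, 0 < delta /\
    forall y, Rabs (y - x) < delta -> Cmod (gamma y - gamma x)%C < eps.
Proof.
  assert (E := filterlim_locally_ball_norm (U := C_R_NormedModule)
                 (F := locally x) gamma (gamma x)).
  split.
  - intros H eps He. assert (K := proj1 E H).
    destruct (K (mkposreal eps He)) as [delta Hd].
    exists delta. split; [apply cond_pos |]. intros y Hy.
    rewrite Cmod_norm. apply Hd. exact Hy.
  - intros H. apply (proj2 E). intros [eps He]. destruct (H eps He) as (delta & Hd & K).
    exists (mkposreal delta Hd). intros y Hy. unfold ball_norm.
    generalize (K y Hy). rewrite Cmod_norm. intros Q. exact Q.
Qed.

Lemma curve_derive_iff (gamma : R -> C) (x : R) (v : C) :
  curve_derive gamma x v <->
  forall eps, 0 < eps -> exists delta, 0 < delta /\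
    forall y, Rabs (y - x) < delta ->
      Cmod (gamma y - gamma x - RtoC (y - x) * v)%C <= eps * Rabs (y - x).
Proof.
  assert (Q : forall y, norm (minus (G := C_R_NormedModule) (minus (gamma y) (gamma x))
                (scal (V := C_R_NormedModule) (minus y x) v))
              = Cmod (gamma y - gamma x - RtoC (y - x) * v)%C).
  { intros y. rewrite Cmod_norm. f_equal.
    destruct (gamma y), (gamma x), v.
    unfold minus, plus, opp, scal, RtoC, Cminus, Cplus, Copp, Cmult; simpl.
    unfold prod_plus, prod_opp, prod_scal; simpl.
    unfold plus, opp, scal; simpl. unfold mult; simpl. f_equal; ring. }
  split.
  - intros [_ H] eps He.
    destruct (H x (fun P HP => HP) (mkposreal eps He)) as [delta Hd].
    exists delta. split; [apply cond_pos |]. intros y Hy.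
    rewrite <- Q. exact (Hd y Hy).
  - intros H. split; [apply is_linear_scal_l |].
    intros x' Hx' [eps He].
    apply (is_filter_lim_locally_unique (V := R_NormedModule)) in Hx'. subst x'.
    destruct (H eps He) as (delta & Hd & K).
    exists (mkposreal delta Hd). intros y Hy.
    eapply Rle_trans; [apply Req_le, Q | apply K, Hy].
Qed.

Lemma continuous_Cmod (gamma : R -> C) (x : R) :
  curve_continuous gamma x -> continuous (fun y => Cmod (gamma y)) x.
Proof.
  intros H. apply filterlim_locally. intros [eps He].
  destruct (proj1 (curve_continuous_iff gamma x) H eps He) as (delta & Hd & K).
  exists (mkposreal delta Hd). intros y Hy.
  eapply Rle_lt_trans; [apply Cmod_triangle_inv | apply K, Hy].
Qed.

Section ArcLength.

Variables (gamma gamma' : R -> C) (a : R).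
Hypothesis gamma_derive : forall x, curve_derive gamma x (gamma' x).
Hypothesis gamma'_continuous : forall x, curve_continuous gamma' x.

Definition arc_length (x : R) : R := RInt (fun u => Cmod (gamma' u)) a x.

Lemma arc_length_derive (x : R) : is_derive arc_length x (Cmod (gamma' x)).
Proof.
  apply (is_derive_RInt (V := R_NormedModule) (fun u => Cmod (gamma' u)) arc_length a).
  - exists (mkposreal 1 Rlt_0_1). intros y _. unfold arc_length.
    apply (RInt_correct (V := R_CompleteNormedModule)).
    apply (ex_RInt_continuous (V := R_CompleteNormedModule)).
    intros z _. apply continuous_Cmod, gamma'_continuous.
  - apply continuous_Cmod, gamma'_continuous.
Qed.

Lemma arc_length_is_RInt (x y : R) :
  is_RInt (fun u => Cmod (gamma' u)) x y (arc_length y - arc_length x).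
Proof.
  apply (is_RInt_derive (V := R_CompleteNormedModule) arc_length).
  - intros u _. apply arc_length_derive.
  - intros u _. apply continuous_Cmod, gamma'_continuous.
Qed.

Lemma curve_is_RInt (x y : R) :
  is_RInt (V := C_R_NormedModule) gamma' x y (gamma y - gamma x)%C.
Proof.
  apply (is_RInt_derive (V := C_R_CompleteNormedModule) gamma gamma').
  - intros u _. apply gamma_derive.
  - intros u _. apply gamma'_continuous.
Qed.

Lemma chord_le_arc (x y : R) :
  x <= y -> Cmod (gamma y - gamma x)%C <= arc_length y - arc_length x.
Proof.
  intros Hxy. rewrite Cmod_norm.
  apply (norm_RInt_le (V := C_R_NormedModule) gamma' (fun u => Cmod (gamma' u)) x y).
  - exact Hxy.
  - intros u _. rewrite Cmod_norm. apply Rle_refl.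
  - apply curve_is_RInt.
  - apply arc_length_is_RInt.
Qed.

(** Near a point where the velocity is not zero the curve is almost straight, so
    the ratio of arc to chord is as close to one as desired. *)
Lemma arc_le_chord_local (u kappa : R) :
  gamma' u <> RtoC 0 -> 1 < kappa ->
  exists delta, 0 < delta /\ forall x y, x <= y ->
    Rabs (x - u) < delta -> Rabs (y - u) < delta ->
    arc_length y - arc_length x <= kappa * Cmod (gamma y - gamma x)%C.
Proof.
  intros Hu Hk. apply Cmod_gt_0 in Hu. set (m := Cmod (gamma' u)) in *.
  (* the choice of e makes m + e = kappa (m - e) *)
  set (e := m * (kappa - 1) / (kappa + 1)).
  assert (He : 0 < e).
  { unfold e. apply Rdiv_lt_0_compat; [apply Rmult_lt_0_compat |]; lra. }
  assert (Ee : m + e = kappa * (m - e)) by (unfold e; field; lra).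
  destruct (proj1 (curve_continuous_iff gamma' u) (gamma'_continuous u) e He)
    as (delta & Hd & K).
  exists delta. split; [exact Hd |]. intros x y Hxy Hx Hy.
  apply Rabs_def2 in Hx. apply Rabs_def2 in Hy.
  assert (K' : forall v, x <= v <= y -> Cmod (gamma' v - gamma' u)%C < e).
  { intros v Hv. apply K. apply Rabs_def1; lra. }
  assert (Up : arc_length y - arc_length x <= (y - x) * (m + e)).
  { eapply Rle_trans; [apply Rle_abs |].
    apply (norm_RInt_le_const (V := R_NormedModule) (fun u => Cmod (gamma' u)) x y);
      [exact Hxy | | apply arc_length_is_RInt].
    intros v Hv. unfold norm; simpl. unfold abs; simpl.
    rewrite Rabs_pos_eq by apply Cmod_ge_0.
    replace (gamma' v) with (gamma' u + (gamma' v - gamma' u))%C by ring.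
    eapply Rle_trans; [apply Cmod_triangle |].
    generalize (K' v Hv). unfold m. lra. }
  assert (Low : Cmod (gamma y - gamma x - RtoC (y - x) * gamma' u)%C <= (y - x) * e).
  { rewrite Cmod_norm.
    apply (norm_RInt_le_const (V := C_R_NormedModule)
             (fun v => minus (G := C_R_NormedModule) (gamma' v) (gamma' u)) x y);
      [exact Hxy | |].
    - intros v Hv. left. generalize (K' v Hv). rewrite Cmod_norm. intros Q. exact Q.
    - replace (gamma y - gamma x - RtoC (y - x) * gamma' u)%C
        with (minus (G := C_R_NormedModule) (gamma y - gamma x)%C
                (scal (V := C_R_NormedModule) (y - x) (gamma' u))).
      + apply (is_RInt_minus (V := C_R_NormedModule)); [apply curve_is_RInt |].
        apply (is_RInt_const (V := C_R_NormedModule)).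
      + destruct (gamma y), (gamma x), (gamma' u).
        unfold minus, plus, opp, scal, RtoC, Cminus, Cplus, Copp, Cmult; simpl.
        unfold prod_plus, prod_opp, prod_scal; simpl.
        unfold plus, opp, scal; simpl. unfold mult; simpl. f_equal; ring. }
  assert (Tri := Cmod_triangle_inv (gamma y - gamma x)%C (RtoC (y - x) * gamma' u)%C).
  rewrite Rabs_minus_sym in Tri.
  rewrite Cmod_mult, Cmod_R, (Rabs_pos_eq (y - x)) in Tri by lra.
  fold m in Tri.
  assert (T := Rle_abs ((y - x) * m - Cmod (gamma y - gamma x)%C)).
  assert (F : (y - x) * (m - e) <= Cmod (gamma y - gamma x)%C) by lra.
  apply Rle_trans with (1 := Up). rewrite Ee.
  replace ((y - x) * (kappa * (m - e))) with (kappa * ((y - x) * (m - e))) by ring.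
  apply Rmult_le_compat_l; [lra | exact F].
Qed.

Lemma curve_continuous_gamma (x : R) : curve_continuous gamma x.
Proof.
  apply (ex_derive_continuous (K := R_AbsRing) (V := C_R_NormedModule) gamma).
  exists (gamma' x). apply gamma_derive.
Qed.

(** Compactness of the square of parameters: near the diagonal the local estimate
    applies, and away from it injectivity keeps the chords long. *)
Lemma arc_le_chord_short (b kappa : R) :
  (forall x, a <= x <= b -> gamma' x <> RtoC 0) ->
  (forall x y, a <= x <= b -> a <= y <= b -> gamma x = gamma y -> x = y) ->
  1 < kappa ->
  exists delta, 0 < delta /\ forall x y, a <= x <= b -> a <= y <= b ->
    Cmod (gamma x - gamma y)%C <= delta ->
    Rabs (arc_length x - arc_length y) <= kappa * Cmod (gamma x - gamma y)%C.
Proof.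
  intros Hnz Hinj Hk.
  assert (Loc : forall u v, exists delta : posreal, a <= u <= b -> a <= v <= b ->
    forall x y, Rabs (x - u) < delta -> Rabs (y - v) < delta ->
      Cmod (gamma x - gamma y)%C <= delta ->
      Rabs (arc_length x - arc_length y) <= kappa * Cmod (gamma x - gamma y)%C).
  { intros u v.
    destruct (classic (a <= u <= b)) as [Hu | Hu]; [| exists (mkposreal 1 Rlt_0_1); tauto].
    destruct (classic (a <= v <= b)) as [Hv | Hv]; [| exists (mkposreal 1 Rlt_0_1); tauto].
    destruct (Req_dec u v) as [<- | Nuv].
    - destruct (arc_le_chord_local u kappa (Hnz u Hu) Hk) as (delta & Hd & K).
      exists (mkposreal delta Hd). intros _ _ x y Hx Hy _. simpl in Hx, Hy.
      destruct (Rle_dec x y) as [L | L].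
      + rewrite Rabs_minus_sym, Cmod_minus_sym, Rabs_pos_eq; [apply K; auto |].
        eapply Rle_trans; [apply Cmod_ge_0 | apply chord_le_arc, L].
      + rewrite Rabs_pos_eq; [apply K; auto; lra |].
        eapply Rle_trans; [apply Cmod_ge_0 | apply chord_le_arc; lra].
    - assert (P : 0 < Cmod (gamma u - gamma v)%C).
      { apply Cmod_gt_0. intros E. apply Nuv, Hinj; [assumption | assumption |].
        replace (gamma u) with ((gamma u - gamma v) + gamma v)%C by ring.
        rewrite E. ring. }
      set (c := Cmod (gamma u - gamma v)%C) in *.
      destruct (proj1 (curve_continuous_iff gamma u) (curve_continuous_gamma u) (c / 4))
        as (d1 & Hd1 & K1); [lra |].
      destruct (proj1 (curve_continuous_iff gamma v) (curve_continuous_gamma v) (c / 4))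
        as (d2 & Hd2 & K2); [lra |].
      assert (Hd : 0 < Rmin (c / 4) (Rmin d1 d2)) by (repeat apply Rmin_pos; lra).
      exists (mkposreal _ Hd). intros _ _ x y Hx Hy Hxy. simpl in Hx, Hy, Hxy.
      exfalso.
      assert (B1 := Rmin_l (c / 4) (Rmin d1 d2)). assert (B2 := Rmin_r (c / 4) (Rmin d1 d2)).
      assert (B3 := Rmin_l d1 d2). assert (B4 := Rmin_r d1 d2).
      assert (C1 := K1 x ltac:(lra)). assert (C2 := K2 y ltac:(lra)).
      assert (T : c <= Cmod (gamma x - gamma u)%C + Cmod (gamma x - gamma y)%C
                       + Cmod (gamma y - gamma v)%C).
      { unfold c. rewrite (Cmod_minus_sym (gamma x) (gamma u)).
        replace (gamma u - gamma v)%C with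
          ((gamma u - gamma x) + (gamma x - gamma y) + (gamma y - gamma v))%C by ring.
        eapply Rle_trans; [apply Cmod_triangle |].
        apply Rplus_le_compat_r, Cmod_triangle. }
      lra. }
  set (delta := fun u v => proj1_sig (constructive_indefinite_description _ (Loc u v))).
  assert (Hdelta : forall u v, a <= u <= b -> a <= v <= b ->
    forall x y, Rabs (x - u) < delta u v -> Rabs (y - v) < delta u v ->
      Cmod (gamma x - gamma y)%C <= delta u v ->
      Rabs (arc_length x - arc_length y) <= kappa * Cmod (gamma x - gamma y)%C).
  { intros u v. unfold delta. apply proj2_sig. }
  destruct (compactness_value_2d a b a b delta) as [d Hd].
  exists d. split; [apply cond_pos |]. intros x y Hx Hy Hxy.
  apply NNPP. intros N. apply (Hd x y Hx Hy).
  intros (u & v & Hu & Hv & Hxu & Hyv & Hduv). apply N.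
  apply (Hdelta u v Hu Hv x y Hxu Hyv). lra.
Qed.

(** Chords are at most as long as arcs, which bounds the measure from above. From below,
    short chords are almost as long as the arcs that they span, so a fine cover of the
    curve is almost a cover of the interval of arc lengths by sets of the same diameters.
    The second bound is taken on [[a, b']] with [b' < b], because a closed curve has
    [gamma a = gamma b]. *)
Theorem length_curve (E : C -> Prop) (b : R) :
  a < b ->
  (forall x, a <= x <= b -> gamma' x <> RtoC 0) ->
  (forall x y, a <= x < b -> a <= y < b -> gamma x = gamma y -> x = y) ->
  (forall z, E z <-> exists x, a <= x <= b /\ z = gamma x) ->
  length E = Finite (RInt (fun x => Cmod (gamma' x)) a b).
Proof.
  intros Hab Hnz Hinj HE.
  assert (A0 : arc_length a = 0) by apply (RInt_point (V := R_CompleteNormedModule)).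
  assert (Acont : forall x, continuous arc_length x).
  { intros x. apply (ex_derive_continuous (K := R_AbsRing) (V := R_NormedModule)).
    exists (Cmod (gamma' x)). apply arc_length_derive. }
  assert (Amono : forall x y, x <= y -> arc_length x <= arc_length y).
  { intros x y Hxy. generalize (chord_le_arc x y Hxy) (Cmod_ge_0 (gamma y - gamma x)%C).
    lra. }
  change (length E = Finite (arc_length b)).
  apply Rbar_is_lub_unique. split.
  - intros s (delta & Hd & ->).
    replace (arc_length b) with (arc_length b - arc_length a) by (rewrite A0; ring).
    apply (hausdorff1_delta_le E gamma arc_length a b delta); [lra | exact Hd | |].
    + intros z Hz. now apply HE.
    + intros x y Hxy _. apply chord_le_arc. lra.
  - intros M HM.
    assert (Low : forall b' kappa, a <= b' < b -> 1 < kappa ->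
              Rbar_le (arc_length b' / kappa) M).
    { intros b' kappa Hb' Hk.
      destruct (arc_le_chord_short b' kappa) as (delta & Hd & K); [| | exact Hk |].
      - intros x Hx. apply Hnz. lra.
      - intros x y Hx Hy. apply Hinj; lra.
      - eapply Rbar_le_trans; [| apply HM; exists delta; split; [exact Hd | reflexivity]].
        replace (arc_length b') with (arc_length b' - arc_length a) by (rewrite A0; ring).
        apply (hausdorff1_delta_ge E gamma arc_length a b'); auto; try lra.
        + apply Amono. lra.
        + intros x Hx. apply HE. exists x. split; [lra | reflexivity]. }
    assert (Low1 : Rbar_le 0 M).
    { generalize (Low a 2 ltac:(lra) ltac:(lra)). rewrite A0.
      replace (0 / 2) with 0 by field. auto. }
    destruct M as [m | |]; simpl in *; [| exact I | contradiction].
    apply Rnot_lt_le. intros Hm.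
    set (m2 := (m + arc_length b) / 2).
    assert (Hm2 : m < m2 < arc_length b) by (unfold m2; lra).
    assert (exists b', a <= b' < b /\ m2 < arc_length b') as (b' & Hb' & Hmb').
    { destruct (proj1 (filterlim_locally arc_length (arc_length b)) (Acont b)
        (mkposreal (arc_length b - m2) ltac:(lra))) as [d Hd].
      set (b' := Rmax a (b - d / 2)).
      assert (Pd := cond_pos d).
      assert (B1 : a <= b') by apply Rmax_l.
      assert (B2 : b - d / 2 <= b') by apply Rmax_r.
      assert (B3 : b' < b) by (apply Rmax_lub_lt; lra).
      exists b'. split; [lra |].
      assert (Q : Rabs (arc_length b' - arc_length b) < arc_length b - m2).
      { apply Hd. unfold ball; simpl. unfold AbsRing_ball, abs, minus, plus, opp; simpl.
        apply Rabs_def1; lra. }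
      apply Rabs_def2 in Q. lra. }
    (* m kappa < m2 for this kappa *)
    set (kappa := 1 + (m2 - m) / (m + 1)).
    assert (Hkap : 1 < kappa).
    { unfold kappa. assert (0 < (m2 - m) / (m + 1)); [| lra].
      apply Rdiv_lt_0_compat; lra. }
    specialize (Low b' kappa Hb' Hkap).
    assert (Q : kappa * m < m2).
    { unfold kappa. replace ((1 + (m2 - m) / (m + 1)) * m)
        with (m2 - (m2 - m) / (m + 1)) by (field; lra).
      assert (0 < (m2 - m) / (m + 1)); [| lra]. apply Rdiv_lt_0_compat; lra. }
    assert (Q2 : arc_length b' <= kappa * m).
    { replace (arc_length b') with (kappa * (arc_length b' / kappa)) by (field; lra).
      apply Rmult_le_compat_l; lra. }
    lra.
Qed.

End ArcLength.

(** * Calculus of strict derivatives *)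

Lemma strict_derive_id (z0 : C) : strict_derive (fun z => z) z0 1.
Proof.
  intros eps He. exists 1. split; [lra |]. intros z w _ _.
  replace (z - w - 1 * (z - w))%C with (RtoC 0) by ring.
  rewrite Cmod_0. apply Rmult_le_pos; [lra | apply Cmod_ge_0].
Qed.

Lemma strict_derive_const (c z0 : C) : strict_derive (fun _ => c) z0 0.
Proof.
  intros eps He. exists 1. split; [lra |]. intros z w _ _.
  replace (c - c - 0 * (z - w))%C with (RtoC 0) by ring.
  rewrite Cmod_0. apply Rmult_le_pos; [lra | apply Cmod_ge_0].
Qed.

Lemma strict_derive_lipschitz (f : C -> C) (z0 d : C) :
  strict_derive f z0 d ->
  exists delta, 0 < delta /\
    forall z w, Cmod (z - z0)%C < delta -> Cmod (w - z0)%C < delta ->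
      Cmod (f z - f w)%C <= (Cmod d + 1) * Cmod (z - w)%C.
Proof.
  intros H. destruct (H 1 Rlt_0_1) as (delta & Hd & K).
  exists delta. split; [exact Hd |]. intros z w Hz Hw.
  replace (f z - f w)%C with ((f z - f w - d * (z - w)) + d * (z - w))%C by ring.
  eapply Rle_trans; [apply Cmod_triangle |].
  rewrite Cmod_mult. generalize (K z w Hz Hw). lra.
Qed.

Lemma strict_derive_continuous (f : C -> C) (z0 d : C) :
  strict_derive f z0 d ->
  forall eps, 0 < eps -> exists delta, 0 < delta /\
    forall z, Cmod (z - z0)%C < delta -> Cmod (f z - f z0)%C < eps.
Proof.
  intros H eps He. destruct (strict_derive_lipschitz f z0 d H) as (delta & Hd & K).
  assert (P := Cmod_ge_0 d).
  exists (Rmin delta (eps / (Cmod d + 1))). split.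
  - apply Rmin_pos; [exact Hd | apply Rdiv_lt_0_compat; lra].
  - intros z Hz.
    assert (H1 := Rmin_l delta (eps / (Cmod d + 1))).
    assert (H2 := Rmin_r delta (eps / (Cmod d + 1))).
    eapply Rle_lt_trans; [apply K; [lra |] |].
    + replace (z0 - z0)%C with (RtoC 0) by ring. rewrite Cmod_0. exact Hd.
    + replace eps with ((Cmod d + 1) * (eps / (Cmod d + 1))) by (field; lra).
      apply Rmult_lt_compat_l; lra.
Qed.

Lemma strict_derive_mult (f g : C -> C) (z0 df dg : C) :
  strict_derive f z0 df -> strict_derive g z0 dg ->
  strict_derive (fun z => f z * g z)%C z0 (df * g z0 + f z0 * dg)%C.
Proof.
  intros Hf Hg eps He.
  assert (P1 := Cmod_ge_0 (f z0)). assert (P2 := Cmod_ge_0 (g z0)).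
  assert (P3 := Cmod_ge_0 df). assert (P4 := Cmod_ge_0 dg).
  (* f z g z - f w g w - (df g z0 + f z0 dg) (z - w) is the sum of four terms,
     each of which is at most M e |z - w| *)
  set (M := Cmod (f z0) + Cmod (g z0) + Cmod df + Cmod dg + 1).
  set (e := Rmin 1 (eps / (4 * M))).
  assert (He0 : 0 < e).
  { apply Rmin_pos; [lra |]. apply Rdiv_lt_0_compat; [lra | unfold M; lra]. }
  assert (He1 : e <= 1) by apply Rmin_l.
  assert (He2 : 4 * M * e <= eps).
  { replace eps with (4 * M * (eps / (4 * M))) by (field; unfold M; lra).
    apply Rmult_le_compat_l; [unfold M; lra | apply Rmin_r]. }
  destruct (Hf e He0) as (d1 & Hd1 & K1).
  destruct (Hg e He0) as (d2 & Hd2 & K2).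
  destruct (strict_derive_continuous f z0 df Hf e He0) as (d3 & Hd3 & K3).
  destruct (strict_derive_continuous g z0 dg Hg e He0) as (d4 & Hd4 & K4).
  exists (Rmin (Rmin d1 d2) (Rmin d3 d4)). split; [repeat apply Rmin_pos; assumption |].
  intros z w Hz Hw.
  assert (B1 := Rmin_l (Rmin d1 d2) (Rmin d3 d4)).
  assert (B2 := Rmin_r (Rmin d1 d2) (Rmin d3 d4)).
  assert (B3 := Rmin_l d1 d2). assert (B4 := Rmin_r d1 d2).
  assert (B5 := Rmin_l d3 d4). assert (B6 := Rmin_r d3 d4).
  specialize (K1 z w ltac:(lra) ltac:(lra)). specialize (K2 z w ltac:(lra) ltac:(lra)).
  specialize (K3 w ltac:(lra)). specialize (K4 z ltac:(lra)).
  assert (D := Cmod_ge_0 (z - w)%C).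
  replace (f z * g z - f w * g w - (df * g z0 + f z0 * dg) * (z - w))%C
    with ((f z - f w - df * (z - w)) * g z + df * (z - w) * (g z - g z0)
          + f w * (g z - g w - dg * (z - w)) + (f w - f z0) * dg * (z - w))%C by ring.
  assert (Gz : Cmod (g z) <= M).
  { replace (g z) with (g z0 + (g z - g z0))%C by ring.
    eapply Rle_trans; [apply Cmod_triangle | unfold M; lra]. }
  assert (Fw : Cmod (f w) <= M).
  { replace (f w) with (f z0 + (f w - f z0))%C by ring.
    eapply Rle_trans; [apply Cmod_triangle | unfold M; lra]. }
  set (r := Cmod (z - w)%C) in *.
  assert (T1 : Cmod ((f z - f w - df * (z - w)) * g z)%C <= e * r * M).
  { rewrite Cmod_mult. apply Rmult_le_compat; auto using Cmod_ge_0. }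
  assert (T2 : Cmod (df * (z - w) * (g z - g z0))%C <= M * r * e).
  { rewrite !Cmod_mult. fold r. apply Rmult_le_compat; auto using Cmod_ge_0; [| | lra].
    - apply Rmult_le_pos; lra.
    - apply Rmult_le_compat_r; [lra | unfold M; lra]. }
  assert (T3 : Cmod (f w * (g z - g w - dg * (z - w)))%C <= M * (e * r)).
  { rewrite Cmod_mult. apply Rmult_le_compat; auto using Cmod_ge_0. }
  assert (T4 : Cmod ((f w - f z0) * dg * (z - w))%C <= e * M * r).
  { rewrite !Cmod_mult. fold r. apply Rmult_le_compat_r; [exact D |].
    apply Rmult_le_compat; auto using Cmod_ge_0; [lra | unfold M; lra]. }
  eapply Rle_trans; [apply Cmod_triangle |].
  eapply Rle_trans; [apply Rplus_le_compat_r, Cmod_triangle |].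
  eapply Rle_trans; [apply Rplus_le_compat_r, Rplus_le_compat_r, Cmod_triangle |].
  apply Rle_trans with (4 * M * e * r); [lra |].
  apply Rmult_le_compat_r; assumption.
Qed.

Lemma strict_derive_comp (f g : C -> C) (z0 df dg : C) :
  strict_derive f (g z0) df -> strict_derive g z0 dg ->
  strict_derive (fun z => f (g z)) z0 (df * dg)%C.
Proof.
  intros Hf Hg eps He.
  assert (P1 := Cmod_ge_0 df). assert (P2 := Cmod_ge_0 dg).
  set (e1 := eps / 2 / (Cmod dg + 1)). set (e2 := eps / 2 / (Cmod df + 1)).
  assert (He1 : 0 < e1) by (apply Rdiv_lt_0_compat; lra).
  assert (He2 : 0 < e2) by (apply Rdiv_lt_0_compat; lra).
  destruct (Hf e1 He1) as (d1 & Hd1 & K1).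
  destruct (Hg e2 He2) as (d2 & Hd2 & K2).
  destruct (strict_derive_lipschitz g z0 dg Hg) as (d3 & Hd3 & K3).
  destruct (strict_derive_continuous g z0 dg Hg d1 Hd1) as (d4 & Hd4 & K4).
  exists (Rmin d2 (Rmin d3 d4)). split; [repeat apply Rmin_pos; assumption |].
  intros z w Hz Hw.
  assert (B1 := Rmin_l d2 (Rmin d3 d4)). assert (B2 := Rmin_r d2 (Rmin d3 d4)).
  assert (B3 := Rmin_l d3 d4). assert (B4 := Rmin_r d3 d4).
  specialize (K1 (g z) (g w) ltac:(apply K4; lra) ltac:(apply K4; lra)).
  specialize (K2 z w ltac:(lra) ltac:(lra)).
  specialize (K3 z w ltac:(lra) ltac:(lra)).
  replace (f (g z) - f (g w) - df * dg * (z - w))%C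
    with ((f (g z) - f (g w) - df * (g z - g w)) + df * (g z - g w - dg * (z - w)))%C
    by ring.
  eapply Rle_trans; [apply Cmod_triangle |]. rewrite Cmod_mult.
  assert (D := Cmod_ge_0 (z - w)%C).
  set (r := Cmod (z - w)%C) in *.
  assert (T1 : e1 * Cmod (g z - g w)%C <= eps / 2 * r).
  { replace (eps / 2 * r) with (e1 * ((Cmod dg + 1) * r)) by (unfold e1; field; lra).
    apply Rmult_le_compat_l; lra. }
  assert (T2 : Cmod df * Cmod (g z - g w - dg * (z - w))%C <= eps / 2 * r).
  { replace (eps / 2 * r) with ((Cmod df + 1) * (e2 * r)) by (unfold e2; field; lra).
    apply Rmult_le_compat; auto using Cmod_ge_0; lra. }
  lra.
Qed.

Lemma strict_derive_pow (n : nat) (z0 : C) :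
  strict_derive (fun z => z ^ n)%C z0 (RtoC (INR n) * z0 ^ pred n)%C.
Proof.
  induction n as [| n IH].
  - intros eps He. exists 1. split; [lra |]. intros z w _ _.
    replace (z ^ 0 - w ^ 0 - RtoC (INR 0) * z0 ^ pred 0 * (z - w))%C with (RtoC 0)
      by (simpl; ring).
    rewrite Cmod_0. apply Rmult_le_pos; [lra | apply Cmod_ge_0].
  - replace (RtoC (INR (S n)) * z0 ^ pred (S n))%C
      with (1 * z0 ^ n + z0 * (RtoC (INR n) * z0 ^ pred n))%C.
    + apply (strict_derive_mult (fun z => z) (fun z => z ^ n)%C);
        [apply strict_derive_id | exact IH].
    + rewrite S_INR, RtoC_plus. simpl pred.
      destruct n as [| n]; [simpl; ring |].
      change (pred (S n)) with n. rewrite !Cpow_S. ring.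
Qed.

Lemma strict_derive_injective (f : C -> C) (z0 d : C) :
  strict_derive f z0 d -> d <> RtoC 0 ->
  exists delta, 0 < delta /\
    forall z w, Cmod (z - z0)%C < delta -> Cmod (w - z0)%C < delta ->
      f z = f w -> z = w.
Proof.
  intros H Hd. apply Cmod_gt_0 in Hd.
  destruct (H (Cmod d / 2)) as (delta & Hdelta & K); [lra |].
  exists delta. split; [exact Hdelta |]. intros z w Hz Hw E.
  specialize (K z w Hz Hw). rewrite E in K.
  replace (f w - f w - d * (z - w))%C with (- (d * (z - w)))%C in K by ring.
  rewrite Cmod_opp, Cmod_mult in K.
  assert (Z : Cmod (z - w)%C = 0).
  { generalize (Cmod_ge_0 (z - w)%C). intros P.
    destruct P as [P | P]; [| now symmetry]. exfalso.
    apply Rmult_le_reg_r in K; [lra | exact P]. }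
  apply Cmod_eq_0 in Z.
  replace z with (w + (z - w))%C by ring. rewrite Z. ring.
Qed.

Lemma strict_derive_curve (f : C -> C) (gamma : R -> C) (x : R) (d v : C) :
  strict_derive f (gamma x) d -> curve_derive gamma x v ->
  curve_derive (fun y => f (gamma y)) x (d * v)%C.
Proof.
  intros Hf Hg. apply curve_derive_iff. intros eps He.
  assert (Hg' := proj1 (curve_derive_iff gamma x v) Hg).
  assert (P1 := Cmod_ge_0 d). assert (P2 := Cmod_ge_0 v).
  set (e1 := eps / 2 / (Cmod v + 1)). set (e2 := eps / 2 / (Cmod d + 1)).
  assert (He1 : 0 < e1) by (apply Rdiv_lt_0_compat; lra).
  assert (He2 : 0 < e2) by (apply Rdiv_lt_0_compat; lra).
  destruct (Hf e1 He1) as (d1 & Hd1 & K1).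
  destruct (Hg' e2 He2) as (d2 & Hd2 & K2).
  destruct (Hg' 1 Rlt_0_1) as (d3 & Hd3 & K3).
  assert (Hd4 : 0 < d1 / (Cmod v + 1)) by (apply Rdiv_lt_0_compat; lra).
  exists (Rmin d2 (Rmin d3 (d1 / (Cmod v + 1)))).
  split; [repeat apply Rmin_pos; assumption |].
  intros y Hy.
  assert (B1 := Rmin_l d2 (Rmin d3 (d1 / (Cmod v + 1)))).
  assert (B2 := Rmin_r d2 (Rmin d3 (d1 / (Cmod v + 1)))).
  assert (B3 := Rmin_l d3 (d1 / (Cmod v + 1))).
  assert (B4 := Rmin_r d3 (d1 / (Cmod v + 1))).
  specialize (K2 y ltac:(lra)). specialize (K3 y ltac:(lra)).
  set (r := Rabs (y - x)) in *.
  assert (Hr : 0 <= r) by apply Rabs_pos.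
  assert (L : Cmod (gamma y - gamma x)%C <= (Cmod v + 1) * r).
  { replace (gamma y - gamma x)%C
      with ((gamma y - gamma x - RtoC (y - x) * v) + RtoC (y - x) * v)%C by ring.
    eapply Rle_trans; [apply Cmod_triangle |].
    rewrite Cmod_mult, Cmod_R. fold r. lra. }
  assert (N1 : Cmod (gamma y - gamma x)%C < d1).
  { eapply Rle_lt_trans; [exact L |].
    replace d1 with ((Cmod v + 1) * (d1 / (Cmod v + 1))) by (field; lra).
    apply Rmult_lt_compat_l; lra. }
  assert (N2 : Cmod (gamma x - gamma x)%C < d1).
  { replace (gamma x - gamma x)%C with (RtoC 0) by ring. rewrite Cmod_0. exact Hd1. }
  specialize (K1 (gamma y) (gamma x) N1 N2).
  replace (f (gamma y) - f (gamma x) - RtoC (y - x) * (d * v))%C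
    with ((f (gamma y) - f (gamma x) - d * (gamma y - gamma x))
          + d * (gamma y - gamma x - RtoC (y - x) * v))%C by ring.
  eapply Rle_trans; [apply Cmod_triangle |]. rewrite Cmod_mult.
  assert (T1 : e1 * Cmod (gamma y - gamma x)%C <= eps / 2 * r).
  { replace (eps / 2 * r) with (e1 * ((Cmod v + 1) * r)) by (unfold e1; field; lra).
    apply Rmult_le_compat_l; lra. }
  assert (T2 : Cmod d * Cmod (gamma y - gamma x - RtoC (y - x) * v)%C <= eps / 2 * r).
  { replace (eps / 2 * r) with ((Cmod d + 1) * (e2 * r)) by (unfold e2; field; lra).
    apply Rmult_le_compat; auto using Cmod_ge_0; lra. }
  lra.
Qed.

Lemma is_derive_iff (f : R -> R) (x l : R) :
  is_derive f x l <->
  forall eps, 0 < eps -> exists delta, 0 < delta /\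
    forall y, Rabs (y - x) < delta ->
      Rabs (f y - f x - (y - x) * l) <= eps * Rabs (y - x).
Proof.
  split.
  - intros [_ H] eps He.
    destruct (H x (fun P HP => HP) (mkposreal eps He)) as [delta Hd].
    exists delta. split; [apply cond_pos |]. intros y Hy. apply (Hd y Hy).
  - intros H. split; [apply is_linear_scal_l |].
    intros x' Hx' [eps He].
    apply (is_filter_lim_locally_unique (V := R_NormedModule)) in Hx'. subst x'.
    destruct (H eps He) as (delta & Hd & K).
    exists (mkposreal delta Hd). intros y Hy. apply (K y Hy).
Qed.

Lemma curve_derive_pair (f g : R -> R) (x a b : R) :
  is_derive f x a -> is_derive g x b ->
  curve_derive (fun y => (f y, g y)) x (a, b).
Proof.
  intros Hf Hg. apply curve_derive_iff. intros eps He.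
  destruct (proj1 (is_derive_iff f x a) Hf (eps / 2)) as (d1 & Hd1 & K1); [lra |].
  destruct (proj1 (is_derive_iff g x b) Hg (eps / 2)) as (d2 & Hd2 & K2); [lra |].
  exists (Rmin d1 d2). split; [now apply Rmin_pos |]. intros y Hy.
  specialize (K1 y (Rlt_le_trans _ _ _ Hy (Rmin_l _ _))).
  specialize (K2 y (Rlt_le_trans _ _ _ Hy (Rmin_r _ _))).
  replace ((f y, g y) - (f x, g x) - RtoC (y - x) * (a, b))%C
    with (f y - f x - (y - x) * a, g y - g x - (y - x) * b).
  - eapply Rle_trans; [apply Cmod_le_Re_Im |]. unfold Re, Im; simpl fst; simpl snd. lra.
  - unfold RtoC, Cminus, Cplus, Copp, Cmult; simpl. f_equal; ring.
Qed.

Lemma curve_derive_Re (gamma : R -> C) (x : R) (v : C) :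
  curve_derive gamma x v -> is_derive (fun y => Re (gamma y)) x (Re v).
Proof.
  intros H. apply is_derive_iff. intros eps He.
  destruct (proj1 (curve_derive_iff gamma x v) H eps He) as (d & Hd & K).
  exists d. split; [exact Hd |]. intros y Hy.
  eapply Rle_trans; [| apply (K y Hy)].
  eapply Rle_trans; [| apply re_le_Cmod]. right. f_equal.
  destruct (gamma y), (gamma x), v. simpl. ring.
Qed.

Lemma curve_derive_Im (gamma : R -> C) (x : R) (v : C) :
  curve_derive gamma x v -> is_derive (fun y => Im (gamma y)) x (Im v).
Proof.
  intros H. apply is_derive_iff. intros eps He.
  destruct (proj1 (curve_derive_iff gamma x v) H eps He) as (d & Hd & K).
  exists d. split; [exact Hd |]. intros y Hy.
  eapply Rle_trans; [| apply (K y Hy)].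
  eapply Rle_trans; [| apply im_le_Cmod]. right. f_equal.
  destruct (gamma y), (gamma x), v. simpl. ring.
Qed.

Lemma curve_derive_ray (z : C) (x : R) :
  curve_derive (fun s => RtoC s * z)%C x z.
Proof.
  apply curve_derive_iff. intros eps He. exists 1. split; [lra |]. intros y _.
  replace (RtoC y * z - RtoC x * z - RtoC (y - x) * z)%C with (RtoC 0)
    by (rewrite RtoC_minus; ring).
  rewrite Cmod_0. apply Rmult_le_pos; [lra | apply Rabs_pos].
Qed.

(** * The binomial series *)

Lemma cps_0 (b : nat -> R) : Rbar_le 1 (CV_radius b) -> cps b 0 = RtoC (b 0%nat).
Proof.
  intros Hb. unfold cps. rewrite cseries_incr_1.
  - rewrite (cseries_ext (fun n => RtoC (b (S n)) * 0 ^ S n)%C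
               (fun n => RtoC 0 * (RtoC (b n) * 0 ^ n))%C).
    + rewrite cseries_scal; [simpl; ring |].
      apply cps_summable; [exact Hb | rewrite Cmod_0; lra].
    + intros n. rewrite Cpow_S. ring.
  - apply cps_summable; [exact Hb | rewrite Cmod_0; lra].
Qed.

Lemma CV_radius_le_compat (a b : nat -> R) :
  (forall n, Rabs (a n) <= Rabs (b n)) -> Rbar_le (CV_radius b) (CV_radius a).
Proof.
  intros H. destruct (CV_radius_bounded a) as [A1 _]. destruct (CV_radius_bounded b) as [_ B2].
  apply B2. intros r [M HM]. apply A1. exists M. intros n.
  eapply Rle_trans; [| apply (HM n)]. rewrite !Rabs_mult.
  apply Rmult_le_compat_r; [apply Rabs_pos | apply H].
Qed.

Lemma CV_radius_scal_INR (b : nat -> R) :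
  CV_radius (fun n => INR n * b n) = CV_radius b.
Proof.
  rewrite <- (CV_radius_derive b), <- (CV_radius_incr_1 (PS_derive b)).
  apply CV_radius_ext. intros [| n]; [simpl; apply Rmult_0_l | reflexivity].
Qed.

Lemma cps_euler (b : nat -> R) (z : C) :
  Rbar_le 1 (CV_radius b) -> Cmod z < 1 ->
  (z * cps (PS_derive b) z)%C = cps (fun n => INR n * b n) z.
Proof.
  intros Hb Hz. unfold cps at 2. rewrite cseries_incr_1.
  - unfold cps. rewrite <- cseries_scal.
    + rewrite (cseries_ext _ (fun n => RtoC (INR (S n) * b (S n)) * z ^ S n)%C).
      * simpl INR. rewrite Rmult_0_l. ring.
      * intros n. unfold PS_derive. rewrite Cpow_S. ring.
    + apply cps_summable; [now rewrite CV_radius_derive | exact Hz].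
  - apply (cps_summable (fun n => INR n * b n)); [| exact Hz].
    now rewrite CV_radius_scal_INR.
Qed.

Lemma cps_plus (a b : nat -> R) (z : C) :
  Rbar_le 1 (CV_radius a) -> Rbar_le 1 (CV_radius b) -> Cmod z < 1 ->
  cps (fun n => a n + b n) z = (cps a z + cps b z)%C.
Proof.
  intros Ha Hb Hz. unfold cps. rewrite <- cseries_plus by now apply cps_summable.
  apply cseries_ext. intros n. rewrite RtoC_plus. ring.
Qed.

Lemma cps_scal (c : R) (b : nat -> R) (z : C) :
  Rbar_le 1 (CV_radius b) -> Cmod z < 1 ->
  cps (fun n => c * b n) z = (RtoC c * cps b z)%C.
Proof.
  intros Hb Hz. unfold cps. rewrite <- cseries_scal by now apply cps_summable.
  apply cseries_ext. intros n. rewrite RtoC_mult. ring.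
Qed.

Lemma cps_ext (a b : nat -> R) (z : C) : (forall n, a n = b n) -> cps a z = cps b z.
Proof.
  intros H. apply cseries_ext. intros n. now rewrite H.
Qed.

(** Taylor coefficients of [(1 - z)^(-a)]. *)
Definition binomial_coeff (a : R) (n : nat) : R := rising a n / INR (fact n).

Lemma binomial_coeff_S (a : R) (n : nat) :
  INR (S n) * binomial_coeff a (S n) = (a + INR n) * binomial_coeff a n.
Proof.
  unfold binomial_coeff. simpl rising. rewrite fact_simpl, mult_INR.
  field. split; [apply INR_fact_neq_0 | apply not_0_INR; lia].
Qed.

(** The coefficients vanish from some point on if [a] is a nonpositive integer, so the
    ratio test is applied to the dominating coefficients for [|a| + 1]. *)
Lemma binomial_coeff_CV (a : R) : Rbar_le 1 (CV_radius (binomial_coeff a)).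
Proof.
  set (m := Rabs a + 1).
  assert (Hm : 0 < m) by (unfold m; generalize (Rabs_pos a); lra).
  assert (Hpos : forall n, 0 < binomial_coeff m n).
  { intros n. unfold binomial_coeff. apply Rdiv_lt_0_compat; [| apply INR_fact_lt_0].
    induction n as [| n IH]; simpl; [lra |].
    apply Rmult_lt_0_compat; [exact IH |]. generalize (pos_INR n). lra. }
  assert (E : CV_radius (binomial_coeff m) = / 1).
  { apply CV_radius_finite_DAlembert; [| lra |].
    - intros n. generalize (Hpos n). lra.
    - apply is_lim_seq_ext with (fun n => 1 + (m - 1) * / (INR n + 1)).
      + intros n. assert (H := binomial_coeff_S m n). assert (P := Hpos n).
        assert (Q := pos_INR n). rewrite S_INR in H.
        replace (binomial_coeff m (S n) / binomial_coeff m n) with ((m + INR n) / (INR n + 1)).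
        * rewrite Rabs_pos_eq; [field; lra |].
          apply Rmult_le_pos; [lra | left; apply Rinv_0_lt_compat; lra].
        * apply Rmult_eq_reg_l with ((INR n + 1) * binomial_coeff m n).
          -- field_simplify; [lra | lra | lra].
          -- apply Rmult_integral_contrapositive. lra.
      + replace (Finite 1) with (Rbar_plus 1 (Rbar_mult (m - 1) 0))
          by (simpl; f_equal; ring).
        apply is_lim_seq_plus'; [apply is_lim_seq_const |].
        apply (is_lim_seq_scal_l _ (m - 1) 0).
        replace (Finite 0) with (Rbar_inv p_infty) by reflexivity.
        apply is_lim_seq_inv; [| discriminate].
        apply is_lim_seq_ext with (fun n => INR (S n)); [intros n; apply S_INR |].
        apply (is_lim_seq_incr_1 INR). apply is_lim_seq_INR. }
  apply Rbar_le_trans with (CV_radius (binomial_coeff m)).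
  - rewrite E. simpl. lra.
  - apply CV_radius_le_compat. intros n.
    rewrite (Rabs_pos_eq (binomial_coeff m n)) by (left; apply Hpos).
    unfold binomial_coeff, Rdiv. rewrite Rabs_mult.
    rewrite (Rabs_pos_eq (/ INR (fact n)))
      by (left; apply Rinv_0_lt_compat, INR_fact_lt_0).
    apply Rmult_le_compat_r; [left; apply Rinv_0_lt_compat, INR_fact_lt_0 |].
    induction n as [| n IH]; simpl; [rewrite Rabs_R1; lra |].
    rewrite Rabs_mult. apply Rmult_le_compat; auto using Rabs_pos.
    eapply Rle_trans; [apply Rabs_triang |].
    rewrite (Rabs_pos_eq (INR n)) by apply pos_INR. unfold m. lra.
Qed.

(** [(n + 1) b_(n+1) = (a + n) b_n] read as an identity of power series. *)
Lemma binomial_ode (a : R) (z : C) :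
  Cmod z < 1 ->
  ((1 - z) * cps (PS_derive (binomial_coeff a)) z = RtoC a * cps (binomial_coeff a) z)%C.
Proof.
  intros Hz. set (b := binomial_coeff a). assert (Hb : Rbar_le 1 (CV_radius b))
    by apply binomial_coeff_CV.
  assert (Hnb : Rbar_le 1 (CV_radius (fun n => INR n * b n)))
    by now rewrite CV_radius_scal_INR.
  assert (E : cps (PS_derive b) z = (RtoC a * cps b z + z * cps (PS_derive b) z)%C).
  { rewrite (cps_euler b z Hb Hz), <- (cps_scal a b z Hb Hz).
    rewrite <- cps_plus; [| | exact Hnb | exact Hz].
    - apply cps_ext. intros n. unfold PS_derive, b. rewrite binomial_coeff_S. ring.
    - destruct (Req_dec a 0) as [-> | Na].
      + rewrite (CV_radius_ext _ (fun _ => 0)) by (intros n; ring).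
        now rewrite CV_radius_const_0.
      + change (Rbar_le 1 (CV_radius (PS_scal a b))).
        now rewrite (CV_radius_scal a b Na). }
  replace ((1 - z) * cps (PS_derive b) z)%C
    with (cps (PS_derive b) z - z * cps (PS_derive b) z)%C by ring.
  rewrite E at 1. ring.
Qed.

(** On the right half-plane [cpow] is given by smooth functions of the coordinates, which
    the piecewise formula for [Arg] hides. *)
Lemma Arg_atan (x y : R) : 0 < x -> Arg (x, y) = atan (y / x).
Proof.
  intros Hx. set (t := atan (y / x)).
  assert (Ht : - PI / 2 < t < PI / 2).
  { unfold t. generalize (atan_bound (y / x)). lra. }
  assert (Hc : x / Cmod (x, y) = cos t).
  { unfold t. rewrite cos_atan. unfold Cmod. simpl fst; simpl snd.
    replace (x ^ 2 + y ^ 2) with (x ^ 2 * (1 + (y / x)²)) by (unfold Rsqr; field; lra).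
    rewrite sqrt_mult_alt by apply pow2_ge_0. rewrite sqrt_pow2 by lra.
    assert (0 < sqrt (1 + (y / x)²)).
    { apply sqrt_lt_R0. generalize (Rle_0_sqr (y / x)). lra. }
    field. lra. }
  unfold Arg. simpl. rewrite Hc.
  destruct (Rle_dec 0 y) as [L | L].
  - apply acos_cos. split; [| lra].
    unfold t. rewrite <- atan_0. destruct (Req_dec y 0) as [-> | N].
    + unfold Rdiv. rewrite Rmult_0_l. apply Rle_refl.
    + left. apply atan_increasing. apply Rdiv_lt_0_compat; lra.
  - rewrite <- cos_neg, acos_cos; [ring |]. split; [| lra].
    assert (t < 0); [| lra].
    unfold t. rewrite <- atan_0. apply atan_increasing.
    replace (y / x) with (- ((- y) / x)) by (field; lra).
    assert (0 < (- y) / x); [| lra]. apply Rdiv_lt_0_compat; lra.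
Qed.

Lemma ln_Cmod (x y : R) : 0 < x -> ln (Cmod (x, y)) = / 2 * ln (x ^ 2 + y ^ 2).
Proof.
  intros Hx. unfold Cmod. simpl fst; simpl snd.
  assert (P : 0 < x ^ 2 + y ^ 2) by (generalize (pow2_ge_0 y) (pow_lt x 2 Hx); lra).
  rewrite <- (sqrt_sqrt (x ^ 2 + y ^ 2)) at 2 by lra.
  rewrite ln_mult by now apply sqrt_lt_R0. field.
Qed.

Lemma cpow_cartesian (x y a : R) :
  0 < x ->
  cpow (x, y) a = (exp (a / 2 * ln (x ^ 2 + y ^ 2)) * cos (a * atan (y / x)),
                   exp (a / 2 * ln (x ^ 2 + y ^ 2)) * sin (a * atan (y / x))).
Proof.
  intros Hx. unfold cpow. rewrite ln_Cmod, Arg_atan by exact Hx.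
  replace (a * (/ 2 * ln (x ^ 2 + y ^ 2))) with (a / 2 * ln (x ^ 2 + y ^ 2)) by field.
  unfold RtoC, Cmult; simpl. f_equal; ring.
Qed.

Lemma Cmod_cpow (w : C) (a : R) : Cmod (cpow w a) = exp (a * ln (Cmod w)).
Proof.
  unfold cpow. rewrite Cmod_mult, Cmod_R, Rabs_pos_eq by (left; apply exp_pos).
  unfold Cmod at 2. cbv [fst snd].
  assert (E : cos (a * Arg w) ^ 2 + sin (a * Arg w) ^ 2 = 1).
  { generalize (sin2_cos2 (a * Arg w)). unfold Rsqr. lra. }
  rewrite E, sqrt_1. ring.
Qed.

(** With [y = A + i B] and [e = X + i Y] the hypotheses are [y' = - a (p + i q) y] and
    [e' = a (p + i q) e], so [y e] is constant; the conclusions are its real and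
    imaginary parts. *)
Lemma product_of_inverse_solutions (A B X Y p q : R -> R) (a : R) :
  (forall s, 0 <= s <= 1 -> is_derive A s (- a * (A s * p s - B s * q s))) ->
  (forall s, 0 <= s <= 1 -> is_derive B s (- a * (A s * q s + B s * p s))) ->
  (forall s, 0 <= s <= 1 -> is_derive X s (a * (p s * X s - q s * Y s))) ->
  (forall s, 0 <= s <= 1 -> is_derive Y s (a * (p s * Y s + q s * X s))) ->
  A 0 * X 0 - B 0 * Y 0 = A 1 * X 1 - B 1 * Y 1 /\
  A 0 * Y 0 + B 0 * X 0 = A 1 * Y 1 + B 1 * X 1.
Proof.
  intros DA DB DX DY.
  assert (EA : forall s, 0 <= s <= 1 ->
    ex_derive (fun x : R => A x) s /\ ex_derive (fun x : R => B x) s /\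
    ex_derive (fun x : R => X x) s /\ ex_derive (fun x : R => Y x) s).
  { intros s Hs. repeat split; eexists; auto. }
  assert (ED : forall s, 0 <= s <= 1 ->
    (Derive (fun x : R => A x) s = - a * (A s * p s - B s * q s) /\
     Derive (fun x : R => B x) s = - a * (A s * q s + B s * p s)) /\
    (Derive (fun x : R => X x) s = a * (p s * X s - q s * Y s) /\
     Derive (fun x : R => Y x) s = a * (p s * Y s + q s * X s))).
  { intros s Hs. repeat split; apply is_derive_unique; auto. }
  split.
  - apply (eq_is_derive (V := R_NormedModule) (fun s => A s * X s - B s * Y s)); [| lra].
    intros s Hs. destruct (EA s Hs) as (E1 & E2 & E3 & E4).
    destruct (ED s Hs) as [[D1 D2] [D3 D4]].
    auto_derive; [tauto |]. rewrite D1, D2, D3, D4. unfold zero; simpl. as_real. ring.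
  - apply (eq_is_derive (V := R_NormedModule) (fun s => A s * Y s + B s * X s)); [| lra].
    intros s Hs. destruct (EA s Hs) as (E1 & E2 & E3 & E4).
    destruct (ED s Hs) as [[D1 D2] [D3 D4]].
    auto_derive; [tauto |]. rewrite D1, D2, D3, D4. unfold zero; simpl. as_real. ring.
Qed.

(** Along the ray [s |-> s w] both [cps (binomial_coeff a)] and
    [(1 - s w)^(-a)] solve [(1 - s w) y' = a w y] with [y 0 = 1]; the product of the
    former with [(1 - s w)^a] therefore has derivative zero. *)
Lemma binomial_series (a : R) (w : C) :
  Cmod w < 1 ->
  (cps (binomial_coeff a) w * cpow (1 - w) a = 1)%C.
Proof.
  intros Hw. set (b := binomial_coeff a).
  destruct w as [u v] eqn:Ew. rewrite <- Ew in *.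
  assert (Hu : Rabs u <= Cmod w) by (rewrite Ew; apply (re_le_Cmod (u, v))).
  assert (Hsw : forall s, 0 <= s <= 1 -> Cmod (RtoC s * w)%C < 1).
  { intros s Hs. rewrite Cmod_mult, Cmod_R, Rabs_pos_eq by lra.
    generalize (Cmod_ge_0 w). nra. }
  assert (Hx : forall s, 0 <= s <= 1 -> 0 < 1 - s * u).
  { intros s Hs. assert (H1 := Rle_abs (s * u)).
    rewrite Rabs_mult, (Rabs_pos_eq s) in H1 by lra.
    assert (H2 : s * Rabs u <= 1 * Rabs u)
      by (apply Rmult_le_compat_r; [apply Rabs_pos | lra]).
    lra. }
  set (f := fun s => cps b (RtoC s * w)%C).
  (* p + i q is the logarithmic derivative of s |-> 1 - s w *)
  set (den := fun s => (1 - s * u) ^ 2 + (- s * v) ^ 2).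
  set (p := fun s => - (u * (1 - s * u) - v * (s * v)) / den s).
  set (q := fun s => - v / den s).
  assert (Hden : forall s, 0 <= s <= 1 -> 0 < den s).
  { intros s Hs. unfold den. generalize (pow_lt _ 2 (Hx s Hs)) (pow2_ge_0 (- s * v)). lra. }
  set (L := fun s => ln ((1 - s * u) ^ 2 + (- s * v) ^ 2)).
  set (M := fun s => atan (- s * v / (1 - s * u))).
  assert (DL : forall s, 0 <= s <= 1 -> is_derive L s (2 * p s)).
  { intros s Hs. assert (P2 := Hden s Hs). unfold L, p. unfold den in *.
    auto_derive; [lra |]. field. lra. }
  assert (DM : forall s, 0 <= s <= 1 -> is_derive M s (q s)).
  { intros s Hs. assert (P1 := Hx s Hs). assert (P2 := Hden s Hs).
    unfold M, q. unfold den in *.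
    auto_derive; [lra |]. unfold Rsqr. field. lra. }
  set (X := fun s => exp (a / 2 * L s) * cos (a * M s)).
  set (Y := fun s => exp (a / 2 * L s) * sin (a * M s)).
  assert (DX : forall s, 0 <= s <= 1 -> is_derive X s (a * (p s * X s - q s * Y s))).
  { intros s Hs. unfold X, Y. auto_derive.
    - split; [exists (2 * p s); auto | split; [exists (q s); auto | exact I]].
    - assert (EL : Derive (fun x : R => L x) s = 2 * p s)
        by exact (is_derive_unique _ _ _ (DL s Hs)).
      assert (EM : Derive (fun x : R => M x) s = q s)
        by exact (is_derive_unique _ _ _ (DM s Hs)).
      rewrite EL, EM. field. }
  assert (DY : forall s, 0 <= s <= 1 -> is_derive Y s (a * (p s * Y s + q s * X s))).
  { intros s Hs. unfold X, Y. auto_derive.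
    - split; [exists (2 * p s); auto | split; [exists (q s); auto | exact I]].
    - assert (EL : Derive (fun x : R => L x) s = 2 * p s)
        by exact (is_derive_unique _ _ _ (DL s Hs)).
      assert (EM : Derive (fun x : R => M x) s = q s)
        by exact (is_derive_unique _ _ _ (DM s Hs)).
      rewrite EL, EM. field. }
  assert (DF : forall s, 0 <= s <= 1 ->
    curve_derive f s (- RtoC a * (f s * (p s, q s)))%C).
  { intros s Hs.
    assert (Z := Hsw s Hs). set (d := cps (PS_derive b) (RtoC s * w)%C).
    assert (C1 : ((1 - RtoC s * w) * (p s, q s) = - w)%C).
    { unfold p, q. assert (P2 := Hden s Hs). rewrite Ew.
      unfold RtoC, Cminus, Cplus, Copp, Cmult; simpl.
      f_equal; field_simplify_eq; try lra; unfold den; ring. }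
    assert (C2 : (d * w = - RtoC a * (f s * (p s, q s)))%C).
    { replace w with (- ((1 - RtoC s * w) * (p s, q s)))%C by (rewrite C1; ring).
      replace (d * - ((1 - RtoC s * w) * (p s, q s)))%C
        with (- (((1 - RtoC s * w) * d) * (p s, q s)))%C by ring.
      unfold d, b. rewrite binomial_ode by exact Z. unfold f, b. ring. }
    rewrite <- C2. unfold f, d.
    apply (strict_derive_curve (cps b) (fun s => RtoC s * w)%C).
    - apply cps_strict_derive; [apply binomial_coeff_CV | exact Z].
    - apply curve_derive_ray. }
  assert (DA : forall s, 0 <= s <= 1 ->
    is_derive (fun s => Re (f s)) s (- a * (Re (f s) * p s - Im (f s) * q s))).
  { intros s Hs. generalize (curve_derive_Re _ _ _ (DF s Hs)).
    destruct (f s). simpl. intros D.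
    match type of D with is_derive _ _ ?l => replace l with (- a * (r * p s - r0 * q s)) in D
      by ring end. exact D. }
  assert (DB : forall s, 0 <= s <= 1 ->
    is_derive (fun s => Im (f s)) s (- a * (Re (f s) * q s + Im (f s) * p s))).
  { intros s Hs. generalize (curve_derive_Im _ _ _ (DF s Hs)).
    destruct (f s). simpl. intros D.
    match type of D with is_derive _ _ ?l => replace l with (- a * (r * q s + r0 * p s)) in D
      by ring end. exact D. }
  assert (F0 : f 0 = 1).
  { unfold f. replace (RtoC 0 * w)%C with (RtoC 0) by ring.
    rewrite cps_0 by apply binomial_coeff_CV. unfold b, binomial_coeff. simpl.
    now replace (1 / 1) with 1 by field. }
  assert (X0 : X 0 = 1).
  { unfold X, L, M. replace ((1 - 0 * u) ^ 2 + (- 0 * v) ^ 2) with 1 by ring.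
    replace (- 0 * v / (1 - 0 * u)) with 0 by field.
    rewrite ln_1, atan_0, !Rmult_0_r, exp_0, cos_0. ring. }
  assert (Y0 : Y 0 = 0).
  { unfold Y, L, M. replace (- 0 * v / (1 - 0 * u)) with 0 by field.
    rewrite atan_0, !Rmult_0_r, sin_0. ring. }
  assert (E1 : (cpow (1 - w) a = (X 1, Y 1))%C).
  { unfold X, Y, L, M. replace (1 - w)%C with (1 - 1 * u, - 1 * v).
    - rewrite cpow_cartesian by (generalize (Hx 1); lra). reflexivity.
    - rewrite Ew. unfold RtoC, Cminus, Cplus, Copp; simpl. f_equal; ring. }
  destruct (product_of_inverse_solutions (fun s => Re (f s)) (fun s => Im (f s))
              X Y p q a DA DB DX DY) as [R1 R2].
  rewrite F0, X0, Y0 in R1, R2.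
  assert (Z1 : Re (RtoC 1) = 1) by reflexivity.
  assert (Z2 : Im (RtoC 1) = 0) by reflexivity.
  rewrite Z1, Z2 in R1, R2.
  assert (F1 : f 1 = cps b w) by (unfold f; f_equal; ring).
  rewrite <- F1, E1. clearbody f. destruct (f 1) as [A B]. unfold Re, Im in R1, R2. simpl in R1, R2.
  unfold RtoC, Cmult; simpl. f_equal; lra.
Qed.

(** * The map F *)

(** The antiderivative of [cps (binomial_coeff a) (z ^ nu)] that vanishes at [0]. *)
Definition binomial_primitive (nu : nat) (a : R) (z : C) : C :=
  (z * cps (fun n => binomial_coeff a n / (INR nu * INR n + 1))%R (z ^ nu))%C.

Lemma Cmod_pow_lt_1 (nu : nat) (z : C) :
  (0 < nu)%nat -> Cmod z < 1 -> Cmod (z ^ nu)%C < 1.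
Proof.
  intros Hnu Hz. rewrite Cmod_pow. apply pow_lt_1_compat; [| exact Hnu].
  split; [apply Cmod_ge_0 | exact Hz].
Qed.

(** If [h_n = b_n / (nu n + 1)], then the product rule gives the coefficients
    [h_n + nu n h_n = b_n]. *)
Lemma binomial_primitive_derive (nu : nat) (a : R) (z : C) :
  (0 < nu)%nat -> Cmod z < 1 ->
  strict_derive (binomial_primitive nu a) z (cps (binomial_coeff a) (z ^ nu)%C).
Proof.
  intros Hnu Hz. assert (Hw := Cmod_pow_lt_1 nu z Hnu Hz).
  set (b := binomial_coeff a). set (h := fun n => b n / (INR nu * INR n + 1)).
  assert (Hden : forall n, 1 <= INR nu * INR n + 1).
  { intros n. generalize (Rmult_le_pos _ _ (pos_INR nu) (pos_INR n)). lra. }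
  assert (Hh : Rbar_le 1 (CV_radius h)).
  { apply Rbar_le_trans with (CV_radius b); [apply binomial_coeff_CV |].
    apply CV_radius_le_compat. intros n. unfold h, Rdiv.
    rewrite Rabs_mult. rewrite <- (Rmult_1_r (Rabs (b n))) at 2.
    apply Rmult_le_compat_l; [apply Rabs_pos |].
    generalize (Hden n). intros D.
    rewrite Rabs_pos_eq by (left; apply Rinv_0_lt_compat; lra).
    rewrite <- Rinv_1. apply Rinv_le_contravar; lra. }
  assert (Hnh : Rbar_le 1 (CV_radius (fun n => INR n * h n)))
    by now rewrite CV_radius_scal_INR.
  assert (E : cps b (z ^ nu)%C
     = (1 * cps h (z ^ nu) + z * (cps (PS_derive h) (z ^ nu) * (RtoC (INR nu) * z ^ pred nu)))%C).
  { replace (z * (cps (PS_derive h) (z ^ nu) * (RtoC (INR nu) * z ^ pred nu)))%C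
      with (RtoC (INR nu) * (z ^ nu * cps (PS_derive h) (z ^ nu)))%C.
    - rewrite Cmult_1_l, cps_euler, <- cps_scal by assumption.
      rewrite <- cps_plus; [| exact Hh | | exact Hw].
      + apply cps_ext. intros n. unfold h. field. generalize (Hden n). lra.
      + change (Rbar_le 1 (CV_radius (PS_scal (INR nu) (fun n => INR n * h n)))).
        rewrite CV_radius_scal; [exact Hnh | apply not_0_INR; lia].
    - destruct nu as [| m]; [lia |]. simpl pred. rewrite Cpow_S. ring. }
  rewrite E.
  apply (strict_derive_mult (fun z => z) (fun z => cps h (z ^ nu)%C));
    [apply strict_derive_id |].
  apply (strict_derive_comp (cps h) (fun z => z ^ nu)%C).
  - now apply cps_strict_derive.
  - apply strict_derive_pow.
Qed.

Lemma Fintegrand_eq (nu : nat) (k : R) (z : C) :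
  (0 < nu)%nat -> Cmod z < 1 ->
  Fintegrand nu k z = cps (binomial_coeff ((k + 1) / INR nu)) (z ^ nu)%C.
Proof.
  intros Hnu Hz. unfold Fintegrand.
  assert (E := binomial_series ((k + 1) / INR nu) _ (Cmod_pow_lt_1 nu z Hnu Hz)).
  set (u := cps _ _) in *. set (v := cpow _ _) in *.
  assert (Hv : v <> RtoC 0).
  { intros Ev. rewrite Ev, Cmult_0_r in E. injection E. lra. }
  replace u with (u * v * / v)%C by (field; exact Hv). rewrite E. ring.
Qed.

(** The fundamental theorem of calculus along the segment from [0] to [z], applied to
    [s |-> G (s z) / z]. *)
Lemma F_eq_primitive (nu : nat) (k : R) (z : C) :
  (0 < nu)%nat -> Cmod z < 1 ->
  F nu k z = binomial_primitive nu ((k + 1) / INR nu) z.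
Proof.
  intros Hnu Hz. set (q := (k + 1) / INR nu). set (G := binomial_primitive nu q).
  assert (G0 : forall s, RtoC s = 0 -> G (RtoC s * z)%C = 0).
  { intros s ->. unfold G, binomial_primitive. ring. }
  destruct (classic (z = RtoC 0)) as [-> | Nz].
  { unfold F, G, binomial_primitive. ring. }
  assert (Hsz : forall s, 0 <= s <= 1 -> Cmod (RtoC s * z)%C < 1).
  { intros s Hs. rewrite Cmod_mult, Cmod_R, Rabs_pos_eq by lra.
    generalize (Cmod_ge_0 z). nra. }
  unfold F.
  rewrite (RInt_ext (V := C_R_CompleteNormedModule) _
             (fun s => cps (binomial_coeff q) ((RtoC s * z) ^ nu)%C)).
  - rewrite (is_RInt_unique (V := C_R_CompleteNormedModule) _ 0 1 (/ z * G z)%C).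
    + field. exact Nz.
    + replace (/ z * G z)%C
        with (minus (G := C_R_NormedModule) (/ z * G (RtoC 1 * z))%C (/ z * G (RtoC 0 * z))%C).
      * apply (is_RInt_derive (V := C_R_CompleteNormedModule)
                 (fun s => / z * G (RtoC s * z))%C).
        -- intros s Hs. rewrite Rmin_left, Rmax_right in Hs by lra.
           replace (cps (binomial_coeff q) ((RtoC s * z) ^ nu)%C)
             with ((0 * G (RtoC s * z) + / z * cps (binomial_coeff q) ((RtoC s * z) ^ nu)) * z)%C
             by (field; exact Nz).
           apply (strict_derive_curve (fun w => / z * G w)%C (fun s => RtoC s * z)%C);
             [| apply curve_derive_ray].
           apply (strict_derive_mult (fun _ => / z)%C G).
           ++ apply strict_derive_const.
           ++ apply binomial_primitive_derive; [exact Hnu | now apply Hsz].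
        -- intros s Hs. rewrite Rmin_left, Rmax_right in Hs by lra.
           apply (ex_derive_continuous (K := R_AbsRing) (V := C_R_NormedModule)
                    (fun s => cps (binomial_coeff q) ((RtoC s * z) ^ nu)%C)).
           eexists.
           apply (strict_derive_curve (fun w => cps (binomial_coeff q) (w ^ nu)%C)
                    (fun s => RtoC s * z)%C); [| apply curve_derive_ray].
           apply (strict_derive_comp (cps (binomial_coeff q)) (fun w => w ^ nu)%C);
             [| apply strict_derive_pow].
           apply cps_strict_derive; [apply binomial_coeff_CV |].
           apply Cmod_pow_lt_1; [exact Hnu | now apply Hsz].
      * rewrite (G0 0) by reflexivity. rewrite Cmult_1_l.
        change (/ z * G z - / z * 0 = / z * G z)%C. ring.
  - intros s Hs. rewrite Rmin_left, Rmax_right in Hs by lra.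
    apply Fintegrand_eq; [exact Hnu | apply Hsz; lra].
Qed.

(** * Inversion of F *)

Lemma ex_derive_Cmod_continuous (phi : C -> C) (z : C) :
  ex_derive (K := C_AbsRing) (V := C_NormedModule) phi z ->
  forall eps, 0 < eps -> exists delta, 0 < delta /\
    forall y, Cmod (y - z)%C < delta -> Cmod (phi y - phi z)%C < eps.
Proof.
  intros H eps He.
  assert (Hc := ex_derive_continuous phi z H).
  assert (K := proj1 (filterlim_locally_ball_norm (U := C_NormedModule)
                        (F := locally (T := AbsRing_UniformSpace C_AbsRing) z) phi (phi z)) Hc).
  destruct (K (mkposreal eps He)) as [delta Hd].
  exists delta. split; [apply cond_pos |]. intros y Hy. apply (Hd y). exact Hy.
Qed.

Lemma cps_binomial_nonzero (a : R) (w : C) :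
  Cmod w < 1 -> cps (binomial_coeff a) w <> RtoC 0.
Proof.
  intros Hw E. assert (H := binomial_series a w Hw).
  rewrite E, Cmult_0_l in H. injection H. lra.
Qed.

(** By hypothesis [phi] is only a continuous right inverse of [F / c]. The points of the
    disk that it recovers form an open and closed set, which
    contains [phi 0]; the segment from [phi 0] to [w] stays in the disk. Openness is the
    local injectivity of [F], whose derivative has no zero. *)
Lemma D_function_left_inverse (nu : nat) (k : R) (c : C) (phi : C -> C) (w : C) :
  (0 < nu)%nat -> c <> RtoC 0 -> is_D_function nu k c phi ->
  Cmod w < 1 -> phi (F nu k w / c)%C = w.
Proof.
  intros Hnu Hc Hphi Hw.
  set (q := (k + 1) / INR nu). set (G := binomial_primitive nu q).
  assert (HF : forall v, Cmod v < 1 -> F nu k v = G v).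
  { intros v Hv. now apply F_eq_primitive. }
  assert (HG : forall v, Cmod v < 1 ->
            strict_derive G v (cps (binomial_coeff q) (v ^ nu)%C)).
  { intros v Hv. now apply binomial_primitive_derive. }
  assert (Hdom : forall v, Cmod v < 1 -> domS nu k c (G v / c)%C).
  { intros v Hv. exists v. split; [exact Hv |]. now rewrite HF. }
  assert (Hright : forall v, Cmod v < 1 ->
            Cmod (phi (G v / c)%C) < 1 /\ G (phi (G v / c)%C) = G v).
  { intros v Hv. destruct (Hphi _ (Hdom v Hv)) as (H1 & H2 & _).
    split; [exact H1 |]. rewrite <- HF by exact H1. rewrite H2. field. exact Hc. }
  assert (Hcont : forall v, Cmod v < 1 -> forall eps, 0 < eps ->
            exists delta, 0 < delta /\ forall u, Cmod (u - v)%C < delta ->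
              Cmod (phi (G u / c)%C - phi (G v / c)%C)%C < eps).
  { intros v Hv eps He. destruct (Hphi _ (Hdom v Hv)) as (_ & _ & H3).
    destruct (ex_derive_Cmod_continuous phi _ H3 eps He) as (d1 & Hd1 & K1).
    assert (Pc : 0 < Cmod c) by now apply Cmod_gt_0.
    destruct (strict_derive_continuous G v _ (HG v Hv) (d1 * Cmod c)) as (d2 & Hd2 & K2);
      [now apply Rmult_lt_0_compat |].
    exists d2. split; [exact Hd2 |]. intros u Hu. apply K1.
    replace (G u / c - G v / c)%C with ((G u - G v) / c)%C by (field; exact Hc).
    rewrite Cmod_div by exact Hc.
    apply Rmult_lt_reg_r with (Cmod c); [exact Pc |].
    unfold Rdiv. rewrite Rmult_assoc, Rinv_l, Rmult_1_r by lra. now apply K2. }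
  assert (H00 : Cmod (RtoC 0) < 1) by (rewrite Cmod_0; lra).
  set (w0 := phi (G 0 / c)%C).
  destruct (Hright 0 H00) as [Hw0 Ew0]. fold w0 in Hw0, Ew0.
  set (path := fun s => (w0 + RtoC s * (w - w0))%C).
  assert (Hpath : forall s, 0 <= s <= 1 -> Cmod (path s) < 1).
  { intros s Hs. unfold path.
    replace (w0 + RtoC s * (w - w0))%C with (RtoC (1 - s) * w0 + RtoC s * w)%C
      by (rewrite RtoC_minus; ring).
    eapply Rle_lt_trans; [apply Cmod_triangle |].
    rewrite !Cmod_mult, !Cmod_R, !Rabs_pos_eq by lra.
    destruct (Req_dec s 1) as [-> | N]; [lra |].
    assert ((1 - s) * Cmod w0 < (1 - s) * 1) by (apply Rmult_lt_compat_l; lra).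
    assert (s * Cmod w <= s * 1) by (apply Rmult_le_compat_l; lra). lra. }
  assert (Hpathc : forall x eps, 0 < eps -> exists delta, 0 < delta /\
            forall y, Rabs (y - x) < delta -> Cmod (path y - path x)%C < eps).
  { intros x eps He. assert (P := Cmod_ge_0 (w - w0)%C).
    exists (eps / (Cmod (w - w0)%C + 1)).
    assert (Q : 0 < eps / (Cmod (w - w0)%C + 1)) by (apply Rdiv_lt_0_compat; lra).
    split; [exact Q |]. intros y Hy. unfold path.
    replace (w0 + RtoC y * (w - w0) - (w0 + RtoC x * (w - w0)))%C
      with (RtoC (y - x) * (w - w0))%C by (rewrite RtoC_minus; ring).
    rewrite Cmod_mult, Cmod_R.
    apply Rle_lt_trans with (Rabs (y - x) * (Cmod (w - w0)%C + 1)).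
    - apply Rmult_le_compat_l; [apply Rabs_pos | lra].
    - apply Rmult_lt_compat_r with (r := Cmod (w - w0)%C + 1) in Hy; [| lra].
      unfold Rdiv in Hy. rewrite Rmult_assoc, Rinv_l, Rmult_1_r in Hy by lra. exact Hy. }
  assert (Fin : phi (G (path 1) / c)%C = path 1).
  { apply (interval_connected (fun s => phi (G (path s) / c)%C = path s) 0 1); [lra | |].
    - unfold path. replace (w0 + RtoC 0 * (w - w0))%C with w0 by ring.
      now rewrite Ew0.
    - intros x Hx. assert (Hxd := Hpath x Hx).
      destruct (classic (phi (G (path x) / c)%C = path x)) as [E | N].
      + destruct (strict_derive_injective G (path x) _ (HG _ Hxd)) as (d1 & Hd1 & K1).
        { apply cps_binomial_nonzero, Cmod_pow_lt_1; assumption. }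
        destruct (Hcont (path x) Hxd d1 Hd1) as (d2 & Hd2 & K2).
        destruct (Hpathc x (Rmin d1 d2)) as (d3 & Hd3 & K3); [now apply Rmin_pos |].
        exists d3. split; [exact Hd3 |]. intros y z _ Hz _ Hzx _.
        assert (Lz := K3 z Hzx).
        assert (B1 := Rmin_l d1 d2). assert (B2 := Rmin_r d1 d2).
        assert (M := K2 (path z) ltac:(lra)). rewrite E in M.
        apply K1; [exact M | lra |]. now apply Hright, Hpath.
      + assert (P : 0 < Cmod (phi (G (path x) / c) - path x)%C).
        { apply Cmod_gt_0. intros Z. apply N.
          replace (phi (G (path x) / c))%C
            with (phi (G (path x) / c) - path x + path x)%C by ring.
          rewrite Z. ring. }
        set (e := Cmod (phi (G (path x) / c) - path x)%C) in *.
        destruct (Hcont (path x) Hxd (e / 2)) as (d2 & Hd2 & K2); [lra |].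
        destruct (Hpathc x (Rmin (e / 2) d2)) as (d3 & Hd3 & K3); [apply Rmin_pos; lra |].
        exists d3. split; [exact Hd3 |]. intros y z _ _ Hy _ Ey. exfalso.
        assert (Ly := K3 y Hy).
        assert (B1 := Rmin_l (e / 2) d2). assert (B2 := Rmin_r (e / 2) d2).
        assert (M := K2 (path y) ltac:(lra)). rewrite Ey in M.
        assert (T : e <= Cmod (path y - path x)%C
                         + Cmod (path y - phi (G (path x) / c)%C)%C); [| lra].
        unfold e. rewrite (Cmod_minus_sym (path y) (phi _)), Rplus_comm.
        replace (phi (G (path x) / c) - path x)%C
          with ((phi (G (path x) / c) - path y) + (path y - path x))%C by ring.
        apply Cmod_triangle. }
  assert (E1 : path 1 = w) by (unfold path; ring).
  rewrite E1 in Fin. now rewrite HF.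
Qed.

(** * Parseval's identity on a circle *)

(** The point [e^(i x)] of the unit circle. *)
Definition cis (x : R) : C := (cos x, sin x).

Lemma Cmod_cis (x : R) : Cmod (cis x) = 1.
Proof.
  unfold Cmod, cis; simpl fst; simpl snd.
  assert (E : cos x ^ 2 + sin x ^ 2 = 1).
  { generalize (sin2_cos2 x). unfold Rsqr. lra. }
  now rewrite E, sqrt_1.
Qed.

Lemma Cmod_polar (r x : R) : 0 <= r -> Cmod (RtoC r * cis x)%C = r.
Proof.
  intros Hr. rewrite Cmod_mult, Cmod_cis, Cmod_R, Rabs_pos_eq by exact Hr. ring.
Qed.

Lemma cis_pow (x : R) (n : nat) : (cis x ^ n)%C = cis (INR n * x).
Proof.
  induction n as [| n IH].
  - simpl. unfold cis. rewrite Rmult_0_l, cos_0, sin_0. reflexivity.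
  - rewrite Cpow_S, IH, S_INR. replace ((INR n + 1) * x) with (x + INR n * x) by ring.
    unfold cis, Cmult; simpl. rewrite cos_plus, sin_plus. f_equal; ring.
Qed.

Lemma polar_pow (r x : R) (n : nat) :
  ((RtoC r * cis x) ^ n)%C = (RtoC (r ^ n) * cis (INR n * x))%C.
Proof.
  now rewrite Cpow_mult_l, cis_pow, RtoC_pow.
Qed.

Lemma cis_derive (x : R) : curve_derive cis x (Ci * cis x)%C.
Proof.
  replace (Ci * cis x)%C with (- sin x, cos x)
    by (unfold Ci, cis, Cmult; simpl; f_equal; ring).
  apply curve_derive_pair.
  - apply is_derive_cos.
  - apply is_derive_sin.
Qed.

Lemma is_RInt_cos_period (j : nat) :
  (0 < j)%nat -> is_RInt (fun x => cos (INR j * x)) 0 (2 * PI) 0.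
Proof.
  intros Hj. assert (Pj : 0 < INR j) by now apply lt_0_INR.
  replace 0 with (minus (G := R_NormedModule) (sin (INR j * (2 * PI)) / INR j)
                    (sin (INR j * 0) / INR j)) at 2.
  - apply (is_RInt_derive (V := R_CompleteNormedModule) (fun x => sin (INR j * x) / INR j)).
    + intros x _. auto_derive; [lra | field; lra].
    + intros x _. apply (ex_derive_continuous (K := R_AbsRing) (V := R_NormedModule)).
      auto_derive. exact I.
  - unfold minus, plus, opp; simpl.
    replace (INR j * (2 * PI)) with (0 + 2 * INR j * PI) by ring.
    rewrite sin_period, Rmult_0_r, sin_0. as_real. field. lra.
Qed.

(** Real and imaginary parts of the sum of [e n * e^(i n nu x)] for [n <= N]. *)
Definition cos_sum (e : nat -> R) (nu N : nat) (x : R) : R :=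
  sum_f_R0 (fun n => e n * cos (INR (n * nu) * x)) N.
Definition sin_sum (e : nat -> R) (nu N : nat) (x : R) : R :=
  sum_f_R0 (fun n => e n * sin (INR (n * nu) * x)) N.

(** By the addition formula each term is [e n * cos ((M - n) nu x)] with [n < M]. *)
Lemma is_RInt_cross_term (e : nat -> R) (nu N M : nat) :
  (0 < nu)%nat -> (N < M)%nat ->
  is_RInt (fun x => cos_sum e nu N x * cos (INR (M * nu) * x)
                    + sin_sum e nu N x * sin (INR (M * nu) * x)) 0 (2 * PI) 0.
Proof.
  intros Hnu. induction N as [| N IH]; intros HM.
  - apply is_RInt_ext with (fun x => scal (e 0%nat) (cos (INR (M * nu) * x))).
    + intros x _. unfold cos_sum, sin_sum, scal; simpl. unfold mult; simpl.
      rewrite Rmult_0_l, cos_0, sin_0. ring.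
    + replace 0 with (scal (V := R_NormedModule) (e 0%nat) 0) at 2
        by (unfold scal; simpl; unfold mult; simpl; ring).
      apply (is_RInt_scal (V := R_NormedModule)), is_RInt_cos_period. lia.
  - apply is_RInt_ext with
      (fun x => plus (cos_sum e nu N x * cos (INR (M * nu) * x)
                      + sin_sum e nu N x * sin (INR (M * nu) * x))
                     (scal (e (S N)) (cos (INR ((M - S N) * nu) * x)))).
    + intros x _. unfold cos_sum, sin_sum, scal, plus; simpl sum_f_R0. simpl. unfold mult; simpl.
      rewrite Nat.mul_sub_distr_r, minus_INR by (apply Nat.mul_le_mono_r; lia).
      rewrite Rmult_minus_distr_r, cos_minus.
      change (nu + N * nu)%nat with (S N * nu)%nat. as_real. ring.
    + replace 0 with (plus (G := R_NormedModule) 0 (scal (V := R_NormedModule) (e (S N)) 0)) at 2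
        by (unfold plus, scal; simpl; unfold mult; simpl; ring).
      apply (is_RInt_plus (V := R_NormedModule)); [apply IH; lia |].
      apply (is_RInt_scal (V := R_NormedModule)), is_RInt_cos_period.
      apply Nat.mul_pos_pos; lia.
Qed.

Lemma parseval_finite (e : nat -> R) (nu N : nat) :
  (0 < nu)%nat ->
  is_RInt (fun x => cos_sum e nu N x ^ 2 + sin_sum e nu N x ^ 2) 0 (2 * PI)
          (2 * PI * sum_f_R0 (fun n => e n ^ 2) N).
Proof.
  intros Hnu.
  assert (Const : forall v, is_RInt (fun _ : R => v ^ 2) 0 (2 * PI) (2 * PI * v ^ 2)).
  { intros v. replace (2 * PI * v ^ 2) with (scal (V := R_NormedModule) (2 * PI - 0) (v ^ 2))
      by (unfold scal; simpl; unfold mult; simpl; ring).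
    apply (is_RInt_const (V := R_NormedModule)). }
  assert (Sq : forall x, cos x ^ 2 + sin x ^ 2 = 1).
  { intros x. generalize (sin2_cos2 x). unfold Rsqr. lra. }
  induction N as [| N IH].
  - apply is_RInt_ext with (fun _ => e 0%nat ^ 2); [| apply Const].
    intros x _. unfold cos_sum, sin_sum. simpl sum_f_R0. as_real.
    simpl Nat.mul. simpl INR. rewrite Rmult_0_l, cos_0, sin_0. ring.
  - apply is_RInt_ext with
      (fun x => plus (cos_sum e nu N x ^ 2 + sin_sum e nu N x ^ 2)
                  (plus (scal (2 * e (S N))
                           (cos_sum e nu N x * cos (INR (S N * nu) * x)
                            + sin_sum e nu N x * sin (INR (S N * nu) * x)))
                        (e (S N) ^ 2))).
    + intros x _. unfold cos_sum, sin_sum. rewrite !tech5.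
      unfold plus, scal, mult; simpl plus.
      rewrite <- (Rmult_1_r (e (S N) ^ 2)), <- (Sq (INR (S N * nu) * x)).
      unfold plus, scal; cbn -[INR Nat.mul sum_f_R0]. unfold mult; cbn -[INR Nat.mul sum_f_R0].
      as_real. ring.
    + rewrite tech5.
      replace (2 * PI * (sum_f_R0 (fun n => e n ^ 2) N + e (S N) ^ 2))
        with (plus (G := R_NormedModule) (2 * PI * sum_f_R0 (fun n => e n ^ 2) N)
               (plus (G := R_NormedModule) (scal (V := R_NormedModule) (2 * e (S N)) 0)
                 (2 * PI * e (S N) ^ 2)))
        by (unfold plus, scal; simpl; unfold mult; simpl; ring).
      apply (is_RInt_plus (V := R_NormedModule)); [exact IH |].
      apply (is_RInt_plus (V := R_NormedModule)); [| apply Const].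
      apply (is_RInt_scal (V := R_NormedModule)), is_RInt_cross_term; [exact Hnu | lia].
Qed.

Lemma cseries_split (u : nat -> C) (N : nat) :
  abs_summable u ->
  cseries u = ((sum_f_R0 (fun n => Re (u n)) N, sum_f_R0 (fun n => Im (u n)) N)
               + cseries (fun n => u (S N + n)%nat))%C.
Proof.
  intros Hu. unfold cseries, Cplus; simpl fst; simpl snd. f_equal.
  - apply (Series_incr_n (fun n => Re (u n)) (S N)); [lia | now apply ex_series_Re].
  - apply (Series_incr_n (fun n => Im (u n)) (S N)); [lia | now apply ex_series_Im].
Qed.

Lemma cps_polar_partial_sum (b : nat -> R) (rho : R) (nu N : nat) (x : R) :
  Rbar_le 1 (CV_radius b) -> 0 <= rho < 1 ->
  Cmod (cps b (RtoC rho * cis (INR nu * x))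
        - (cos_sum (fun n => b n * rho ^ n)%R nu N x,
           sin_sum (fun n => b n * rho ^ n)%R nu N x))%C
  <= Series (fun n => Rabs (b n) * rho ^ n)
     - sum_f_R0 (fun n => Rabs (b n) * rho ^ n) N.
Proof.
  intros Hb Hr. set (z := (RtoC rho * cis (INR nu * x))%C).
  assert (Hz : Cmod z < 1) by (unfold z; rewrite Cmod_polar; lra).
  assert (Hex := CV_abs_ex_series b rho Hb Hr).
  set (B := fun n => Rabs (b n) * rho ^ n) in *.
  assert (Term : forall n, (RtoC (b n) * z ^ n)%C
            = (b n * rho ^ n * cos (INR (n * nu) * x), b n * rho ^ n * sin (INR (n * nu) * x))).
  { intros n. unfold z. rewrite polar_pow, mult_INR, <- Rmult_assoc.
    unfold RtoC, cis, Cmult; simpl. f_equal; ring. }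
  unfold cps. rewrite (cseries_split _ N) by now apply cps_summable.
  match goal with |- Cmod (?u + ?t - ?v)%C <= _ => replace (u + t - v)%C with t end.
  - assert (E : Series B - sum_f_R0 B N = Series (fun n => B (S N + n)%nat)).
    { rewrite (Series_incr_n B (S N)); [simpl pred; ring | lia | exact Hex]. }
    rewrite E. apply Cmod_cseries_le.
    + intros n. unfold B. rewrite Cmod_mult, Cmod_R, Cmod_pow.
      unfold z. rewrite Cmod_polar by lra. apply Rle_refl.
    + now apply (ex_series_incr_n B (S N)).
  - match goal with |- ?t = (?u + ?t' - ?v)%C => assert (E : u = v) end.
    { unfold cos_sum, sin_sum. f_equal; apply sum_eq; intros n _; rewrite Term; reflexivity. }
    rewrite E. ring.
Qed.

(** Parseval's identity; the partial sums converge uniformly on the circle. *)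
Lemma parseval (b : nat -> R) (rho : R) (nu : nat) :
  Rbar_le 1 (CV_radius b) -> 0 <= rho < 1 -> (0 < nu)%nat ->
  is_RInt (fun x => Cmod (cps b (RtoC rho * cis (INR nu * x))%C) ^ 2) 0 (2 * PI)
          (2 * PI * Series (fun n => (b n * rho ^ n) ^ 2)).
Proof.
  intros Hb Hr Hnu. set (e := fun n => b n * rho ^ n).
  assert (Hex := CV_abs_ex_series b rho Hb Hr).
  set (B := fun n => Rabs (b n) * rho ^ n) in *.
  assert (HB : forall n, 0 <= B n).
  { intros n. apply Rmult_le_pos; [apply Rabs_pos | apply pow_le; lra]. }
  set (m := Series B). assert (Hm : 0 <= m) by now apply Series_nonneg.
  set (g := fun x => Cmod (cps b (RtoC rho * cis (INR nu * x))%C) ^ 2).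
  set (f := fun N x => cos_sum e nu N x ^ 2 + sin_sum e nu N x ^ 2).
  assert (Close : forall N x, Rabs (f N x - g x) <= (m - sum_f_R0 B N) * (3 * m)).
  { intros N x. assert (H := cps_polar_partial_sum b rho nu N x Hb Hr).
    fold B in H. fold e in H. fold m in H.
    set (h := (cos_sum e nu N x, sin_sum e nu N x)) in *.
    assert (Ef : f N x = Cmod h ^ 2) by (rewrite Cmod2_alt; reflexivity).
    unfold g. set (l := cps b _) in *.
    assert (Hl : Cmod l <= m).
    { apply Cmod_cseries_le; [| exact Hex]. intros n. unfold B.
      rewrite Cmod_mult, Cmod_R, Cmod_pow, Cmod_polar by lra. apply Rle_refl. }
    assert (S0 : 0 <= sum_f_R0 B N) by (apply cond_pos_sum; exact HB).
    assert (Hh : Cmod h <= 2 * m).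
    { replace h with (l - (l - h))%C by ring.
      eapply Rle_trans; [apply Cmod_triangle_minus | lra]. }
    rewrite Ef. replace (Cmod h ^ 2 - Cmod l ^ 2) with ((Cmod h - Cmod l) * (Cmod h + Cmod l))
      by ring.
    rewrite Rabs_mult. assert (P1 := Cmod_ge_0 h). assert (P2 := Cmod_ge_0 l).
    rewrite (Rabs_pos_eq (Cmod h + Cmod l)) by lra.
    apply Rmult_le_compat; [apply Rabs_pos | lra | | lra].
    rewrite Rabs_minus_sym. eapply Rle_trans; [apply Cmod_triangle_inv | exact H]. }
  destruct (filterlim_RInt (V := R_CompleteNormedModule) f 0 (2 * PI) eventually _ g
              (fun N => 2 * PI * sum_f_R0 (fun n => e n ^ 2) N)) as (I & HI1 & HI2).
  - intros N. now apply parseval_finite.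
  - apply (filterlim_locally (U := fct_UniformSpace R R_UniformSpace) f g).
    intros [eps He].
    assert (Hlim := Series_correct B Hex).
    assert (Heta : 0 < eps / (3 * m + 1)) by (apply Rdiv_lt_0_compat; lra).
    destruct (proj1 (filterlim_locally (sum_n B) (Series B)) Hlim (mkposreal _ Heta)) as [N0 HN0].
    exists N0. intros N HN x.
    assert (Q : Rabs (sum_n B N - m) < eps / (3 * m + 1)) by apply (HN0 N HN).
    rewrite sum_n_Reals in Q. apply Rabs_def2 in Q.
    apply Rle_lt_trans with (1 := Close N x).
    assert (T : (m - sum_f_R0 B N) * (3 * m) <= eps / (3 * m + 1) * (3 * m))
      by (apply Rmult_le_compat_r; lra).
    eapply Rle_lt_trans; [exact T |].
    assert (Z : eps / (3 * m + 1) * (3 * m + 1) = eps) by (field; lra).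
    simpl. lra.
  - assert (Ppi := PI_RGT_0).
    assert (HS : is_series (fun n => e n ^ 2) (/ (2 * PI) * I)).
    { assert (L : is_lim_seq (fun N => / (2 * PI) * (2 * PI * sum_f_R0 (fun n => e n ^ 2) N))
                    (Rbar_mult (/ (2 * PI)) I)).
      { apply is_lim_seq_scal_l. exact HI1. }
      unfold is_series. apply (is_lim_seq_ext _ (sum_n (fun n => e n ^ 2))) in L; [exact L |].
      intros N. rewrite sum_n_Reals. field. lra. }
    assert (ES : Series (fun n => (b n * rho ^ n) ^ 2) = / (2 * PI) * I)
      by exact (is_series_unique _ _ HS).
    rewrite ES.
    rewrite <- Rmult_assoc, Rinv_r, Rmult_1_l by lra. exact HI2.
Qed.

(** * The level sets *)

Lemma polar_form (w : C) :
  w <> RtoC 0 -> exists x, 0 <= x <= 2 * PI /\ w = (RtoC (Cmod w) * cis x)%C.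
Proof.
  intros Hw. assert (P := proj1 (Cmod_gt_0 w) Hw). set (r := Cmod w) in *.
  assert (E : Re w ^ 2 + Im w ^ 2 = r ^ 2) by (unfold r; now rewrite Cmod2_alt).
  set (t := acos (Re w / r)).
  assert (B : -1 <= Re w / r <= 1).
  { assert (H := re_le_Cmod w). fold r in H. apply Rabs_le_between in H.
    split; apply Rmult_le_reg_r with r; try exact P;
      unfold Rdiv; rewrite Rmult_assoc, Rinv_l by lra; lra. }
  assert (Bt : 0 <= t <= PI) by apply acos_bound.
  assert (Ct : r * cos t = Re w) by (unfold t; rewrite cos_acos by exact B; field; lra).
  assert (St0 : 0 <= sin t) by (apply sin_ge_0; lra).
  assert (St : (r * sin t) ^ 2 = Im w ^ 2).
  { generalize (sin2_cos2 t). unfold Rsqr. intros S.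
    replace ((r * sin t) ^ 2) with (r ^ 2 * (sin t * sin t)) by ring.
    replace (sin t * sin t) with (1 - cos t * cos t) by lra.
    replace (r ^ 2 * (1 - cos t * cos t)) with (r ^ 2 - (r * cos t) ^ 2) by ring.
    rewrite Ct. lra. }
  assert (Pr : 0 <= r * sin t) by (apply Rmult_le_pos; lra).
  assert (Form : forall x, r * cos x = Re w -> r * sin x = Im w -> w = (RtoC r * cis x)%C).
  { intros x H1 H2. destruct w as [a b]. simpl in H1, H2.
    unfold RtoC, cis, Cmult; simpl. f_equal; lra. }
  destruct (Rle_dec 0 (Im w)) as [L | L].
  - exists t. split; [lra |]. apply Form; [exact Ct |]. nra.
  - exists (2 * PI - t). split; [lra |].
    assert (C1 : cos (2 * PI - t) = cos t).
    { rewrite <- (cos_neg t), <- (cos_period (- t) 1). f_equal. simpl. ring. }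
    assert (S1 : sin (2 * PI - t) = - sin t).
    { rewrite <- (sin_neg t), <- (sin_period (- t) 1). f_equal. simpl. ring. }
    apply Form; [rewrite C1; exact Ct | rewrite S1]. nra.
Qed.

Lemma cis_injective (x y : R) :
  0 <= x < 2 * PI -> 0 <= y < 2 * PI -> cis x = cis y -> x = y.
Proof.
  assert (W : forall u v, 0 <= u <= v -> v < 2 * PI -> cis u = cis v -> u = v).
  { intros u v Hu Hv E. injection E. intros ES EC.
    assert (C1 : cos (v - u) = 1).
    { rewrite cos_minus, EC, ES. generalize (sin2_cos2 v). unfold Rsqr. lra. }
    replace (v - u) with (2 * ((v - u) / 2)) in C1 by field.
    rewrite cos_2a_sin in C1.
    destruct (Rle_lt_or_eq_dec 0 ((v - u) / 2)) as [L | L]; [lra | | lra].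
    assert (0 < sin ((v - u) / 2)) by (apply sin_gt_0; lra). nra. }
  intros Hx Hy E. destruct (Rle_dec x y) as [L | L].
  - apply W; [lra | lra | exact E].
  - symmetry. apply W; [lra | lra | now symmetry].
Qed.

Lemma cps_binomial_Cmod (a : R) (w : C) :
  Cmod w < 1 -> Cmod (cps (binomial_coeff a) w) = exp (- a * ln (Cmod (1 - w)%C)).
Proof.
  intros Hw. assert (E := f_equal Cmod (binomial_series a w Hw)).
  rewrite Cmod_mult, Cmod_1, Cmod_cpow in E.
  replace (- a * ln (Cmod (1 - w)%C)) with (- (a * ln (Cmod (1 - w)%C))) by ring.
  rewrite exp_Ropp.
  assert (P := exp_pos (a * ln (Cmod (1 - w)%C))).
  apply Rmult_eq_reg_r with (exp (a * ln (Cmod (1 - w)%C))); [| lra].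
  rewrite E. field. lra.
Qed.

Lemma pow_exp (x : R) (n : nat) : exp x ^ n = exp (INR n * x).
Proof.
  induction n as [| n IH]; [simpl; now rewrite Rmult_0_l, exp_0 |].
  simpl pow. rewrite IH, <- exp_plus, S_INR. f_equal. ring.
Qed.

Lemma rising_1 (n : nat) : rising 1 n = INR (fact n).
Proof.
  induction n as [| n IH]; [reflexivity |].
  simpl rising. rewrite IH, fact_simpl, mult_INR, S_INR. ring.
Qed.

(** Since [rising 1 n = n!], the coefficients of the Gauss series are squares. *)
Lemma hyp2F1_eq_sum_squares (p rho : R) :
  hyp2F1 p p 1 (rho ^ 2) = Series (fun n => (binomial_coeff p n * rho ^ n) ^ 2).
Proof.
  unfold hyp2F1, PSeries. apply Series_ext. intros n.
  rewrite rising_1, <- pow_mult, Nat.mul_comm, pow_mult.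
  unfold binomial_coeff. field. apply INR_fact_neq_0.
Qed.

Lemma curve_continuous_strict (f : C -> C) (d : C) (gamma : R -> C) (v : C) (x : R) :
  strict_derive f (gamma x) d -> curve_derive gamma x v ->
  curve_continuous (fun y => f (gamma y)) x.
Proof.
  intros Hf Hg.
  apply (ex_derive_continuous (K := R_AbsRing) (V := C_R_NormedModule) (fun y => f (gamma y))).
  exists (d * v)%C. now apply strict_derive_curve.
Qed.

Lemma circle_derive (r x : R) :
  curve_derive (fun y => RtoC r * cis y)%C x (RtoC r * (Ci * cis x))%C.
Proof.
  replace (RtoC r * (Ci * cis x))%C
    with ((0 * cis x + RtoC r * 1) * (Ci * cis x))%C by ring.
  apply (strict_derive_curve (fun z => RtoC r * z)%C cis); [| apply cis_derive].
  apply (strict_derive_mult (fun _ => RtoC r) (fun z => z));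
    [apply strict_derive_const | apply strict_derive_id].
Qed.

(** A point [z] of the level set is the image of [phi z], because [phi] is a right inverse;
    conversely every point of the circle is attained and the image avoids [0], because it
    is a left inverse. *)
Lemma level_set_image (nu : nat) (k : R) (c : C) (phi : C -> C) (t : R) (z : C) :
  (0 < nu)%nat -> c <> RtoC 0 -> is_D_function nu k c phi -> t < 0 ->
  level_set (Sstar nu k c) phi t z <->
  exists x, 0 <= x <= 2 * PI /\ z = (F nu k (RtoC (exp t) * cis x) / c)%C.
Proof.
  intros Hnu Hc Hphi Ht.
  assert (Pt := exp_pos t).
  assert (Lt : exp t < 1) by (rewrite <- exp_0; now apply exp_increasing).
  split.
  - intros [[HS Hz] [Hne Hln]].
    destruct (Hphi z HS) as (_ & HF & _).
    assert (P := proj1 (Cmod_gt_0 _) Hne).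
    destruct (polar_form (phi z) Hne) as (x & Hx & E).
    exists x. split; [exact Hx |].
    rewrite <- Hln, exp_ln, <- E, HF by exact P. field. exact Hc.
  - intros (x & Hx & ->).
    assert (Hw : Cmod (RtoC (exp t) * cis x)%C < 1) by (rewrite Cmod_polar; lra).
    set (w := (RtoC (exp t) * cis x)%C) in *.
    assert (Nw : w <> RtoC 0).
    { apply Cmod_gt_0. unfold w. rewrite Cmod_polar; lra. }
    assert (Inv := D_function_left_inverse nu k c phi w Hnu Hc Hphi Hw).
    assert (F0 : (F nu k 0 / c = 0)%C) by (unfold F; field; exact Hc).
    split; [split |].
    + exists w. split; [exact Hw | reflexivity].
    + intros E. apply Nw.
      assert (Inv0 := D_function_left_inverse nu k c phi 0 Hnu Hc Hphi
                        ltac:(rewrite Cmod_0; lra)).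
      rewrite F0 in Inv0. rewrite E, Inv0 in Inv. now symmetry.
    + rewrite Inv. split; [exact Nw |]. unfold w.
      rewrite Cmod_polar by lra. apply ln_exp.
Qed.

Theorem theorem3 :
  forall (nu : nat) (k : R) (c : C) (phi : C -> C),
    (0 < nu)%nat ->
    k <= INR nu - 1 ->
    c <> RtoC 0 ->
    is_D_function nu k c phi ->
    let p := (k + 1) / (2 * INR nu) in
    forall t : R, t < 0 ->
      length (level_set (Sstar nu k c) phi t) =
      Finite (2 * PI * exp t / Cmod c * hyp2F1 p p 1 (exp (2 * INR nu * t))).
Proof.
  intros nu k c phi Hnu _ Hc Hphi p t Ht.
  set (r := exp t).
  assert (Hr0 : 0 < r) by apply exp_pos.
  assert (Hr1 : r < 1) by (unfold r; rewrite <- exp_0; now apply exp_increasing).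
  assert (Pc : 0 < Cmod c) by now apply Cmod_gt_0.
  assert (Pnu : 0 < INR nu) by now apply lt_0_INR.
  set (q := (k + 1) / INR nu).
  set (G := binomial_primitive nu q).
  set (dG := fun z => cps (binomial_coeff q) (z ^ nu)%C).
  set (circle := fun x => (RtoC r * cis x)%C).
  assert (Hdisk : forall x, Cmod (circle x) < 1).
  { intros x. unfold circle. rewrite Cmod_polar; lra. }
  set (gamma := fun x => (G (circle x) * / c)%C).
  (* the derivative of e^(i x) is i e^(i x) *)
  set (gamma' := fun x => (dG (circle x) * circle x * (Ci * / c))%C).
  assert (Dg : forall x, curve_derive gamma x (gamma' x)).
  { intros x. unfold gamma, gamma'.
    replace (dG (circle x) * circle x * (Ci * / c))%C
      with ((dG (circle x) * / c + G (circle x) * 0) * (RtoC r * (Ci * cis x)))%C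
      by (unfold circle; ring).
    apply (strict_derive_curve (fun z => G z * / c)%C circle).
    - apply (strict_derive_mult G (fun _ => / c)%C); [| apply strict_derive_const].
      now apply binomial_primitive_derive.
    - apply circle_derive. }
  assert (Cg : forall x, curve_continuous gamma' x).
  { intros x.
    eapply (curve_continuous_strict (fun z => dG z * z * (Ci * / c))%C _ circle);
      [| apply circle_derive].
    apply (strict_derive_mult (fun z => dG z * z)%C); [| apply strict_derive_const].
    apply (strict_derive_mult dG (fun z => z)); [| apply strict_derive_id].
    apply (strict_derive_comp (cps (binomial_coeff q)) (fun z => z ^ nu)%C);
      [| apply strict_derive_pow].
    apply cps_strict_derive; [apply binomial_coeff_CV | now apply Cmod_pow_lt_1]. }
  assert (HF : forall x, (F nu k (circle x) / c)%C = gamma x).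
  { intros x. now rewrite F_eq_primitive. }
  assert (Inj : forall x y, 0 <= x < 2 * PI -> 0 <= y < 2 * PI -> gamma x = gamma y -> x = y).
  { intros x y Hx Hy E. apply cis_injective; [exact Hx | exact Hy |].
    assert (Ec : circle x = circle y).
    { rewrite <- (D_function_left_inverse nu k c phi (circle x)) by auto.
      rewrite <- (D_function_left_inverse nu k c phi (circle y)) by auto.
      now rewrite !HF, E. }
    assert (Nr : RtoC r <> 0) by (intros Er; injection Er; lra).
    replace (cis x) with (/ RtoC r * circle x)%C by (unfold circle; field; exact Nr).
    rewrite Ec. unfold circle. field. exact Nr. }
  (* q = 2 p, hence |1 - w|^(-q) = (|1 - w|^(-p))^2 *)
  assert (Speed : forall x, Cmod (gamma' x)
    = r / Cmod c * Cmod (cps (binomial_coeff p) (RtoC (r ^ nu) * cis (INR nu * x))%C) ^ 2).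
  { intros x. unfold gamma'. rewrite !Cmod_mult, Cmod_Ci, Cmod_inv by exact Hc.
    unfold dG. rewrite <- polar_pow. fold (circle x).
    assert (Hw := Cmod_pow_lt_1 nu (circle x) Hnu (Hdisk x)).
    rewrite !cps_binomial_Cmod by exact Hw.
    assert (Er : Cmod (circle x) = r) by (unfold circle; rewrite Cmod_polar; lra).
    rewrite Er. simpl pow. rewrite Rmult_1_r, <- exp_plus.
    replace (- p * ln (Cmod (1 - circle x ^ nu)%C) + - p * ln (Cmod (1 - circle x ^ nu)%C))
      with (- q * ln (Cmod (1 - circle x ^ nu)%C)) by (unfold p, q; field; lra).
    field. lra. }
  assert (Ppi := PI_RGT_0).
  rewrite (length_curve gamma gamma' 0 Dg Cg _ (2 * PI)); [| lra | | exact Inj |].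
  - f_equal.
    replace (exp (2 * INR nu * t)) with ((r ^ nu) ^ 2).
    + rewrite hyp2F1_eq_sum_squares. apply is_RInt_unique.
      apply (is_RInt_ext (fun x => scal (r / Cmod c)
        (Cmod (cps (binomial_coeff p) (RtoC (r ^ nu) * cis (INR nu * x))%C) ^ 2))).
      * intros x _. symmetry. apply Speed.
      * replace (2 * PI * r / Cmod c * Series (fun n => (binomial_coeff p n * (r ^ nu) ^ n) ^ 2))
          with (scal (V := R_NormedModule) (r / Cmod c)
                 (2 * PI * Series (fun n => (binomial_coeff p n * (r ^ nu) ^ n) ^ 2))).
        -- apply (is_RInt_scal (V := R_NormedModule)), parseval;
             [apply binomial_coeff_CV | | exact Hnu].
           split; [apply pow_le; lra |].
           apply pow_lt_1_compat; [lra | exact Hnu].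
        -- unfold scal; simpl. unfold mult; simpl. field. lra.
    + unfold r. rewrite <- pow_mult, pow_exp. f_equal. rewrite mult_INR. simpl. ring.
  - intros x _ E.
    assert (Z : Cmod (gamma' x) <> 0); [| rewrite E, Cmod_0 in Z; now apply Z].
    rewrite Speed. apply Rgt_not_eq, Rmult_lt_0_compat; [now apply Rdiv_lt_0_compat |].
    apply pow_lt, Cmod_gt_0, cps_binomial_nonzero.
    rewrite <- polar_pow. exact (Cmod_pow_lt_1 nu _ Hnu (Hdisk x)).
  - intros z. apply iff_trans with (1 := level_set_image nu k c phi t z Hnu Hc Hphi Ht).
    fold r. split; intros (x & Hx & ->); exists x; (split; [exact Hx |]).
    + apply HF.
    + symmetry. apply HF.
Qed.
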